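(* Let $p$ be a prime and let $c$ be an integer. Then \[ \sum_{\substack{r\in\mathbb{Z},\ |r|<2\sqrt p,\\ r\equiv c\pmod 7}}H(4p-r^2)= \begin{cases} \frac{p+1}{3}, & c\equiv 0\pmod 7,\ p\equiv 3,5\pmod 7,\\ \frac{p-5}{3}, & c\equiv 0\pmod 7,\ p\equiv 6\pmod 7,\\ \frac{p-2}{3}, & c\equiv \pm(p+1)\pmod 7,\ p\equiv 2,3,4,5\pmod 7,\\ \frac{p+1}{3}, & c\equiv\pm 2\pmod 7,\ p\equiv 6\pmod 7. \end{cases} \]
   Context: $H(N)$ denotes the Hurwitz class number: for an integer $N\ge 0$, $H(0)=-1/12$; $H(N)=0$ if $N\equiv 1,2\pmod 4$; otherwise $H(N)$ is the number of $\mathrm{SL}_2(\mathbb{Z})$-equivalence classes of (not necessarily primitive) positive definite binary quadratic forms of discriminant $-N$, where classes containing a multiple of $x^2+y^2$ are counted with weight $1/2$ and classes containing a multiple of $x^2+xy+y^2$ are counted with weight $1/3$. The sum runs over all integers $r$ (positive, negative and zero) satisfying the stated conditions. *)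

(* Defs.v *)
From HB Require Import structures.
From mathcomp Require Import all_boot all_order all_algebra.
From Stdlib Require Import ClassicalEpsilon.
Set Implicit Arguments. Unset Strict Implicit. Unset Printing Implicit Defensive.
Import Order.TTheory GRing.Theory Num.Theory.
Local Open Scope ring_scope.

(* A binary quadratic form a x^2 + b x y + c y^2, encoded as (a, b, c). *)
Definition bqf := (int * int * int)%type.
Definition qa (f : bqf) : int := f.1.1.
Definition qb (f : bqf) : int := f.1.2.
Definition qc (f : bqf) : int := f.2.

Definition disc (f : bqf) : int := qb f ^+ 2 - 4 * qa f * qc f.

Definition posdef (f : bqf) : bool := (disc f < 0) && (0 < qa f).

(* f o g where g = [[al, be], [ga, de]] : (x,y) |-> (al x + be y, ga x + de y) *)
Definition act (f : bqf) (al be ga de : int) : bqf :=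
  let a := qa f in let b := qb f in let c := qc f in
  (a * al ^+ 2 + b * al * ga + c * ga ^+ 2,
   2 * a * al * be + b * (al * de + be * ga) + 2 * c * ga * de,
   a * be ^+ 2 + b * be * de + c * de ^+ 2).

Definition sl2_equiv (f g : bqf) : Prop :=
  exists al be ga de : int, al * de - be * ga = 1 /\ g = act f al be ga de.

Definition cls_weight (f : bqf) : rat :=
  if excluded_middle_informative (exists k : int, 0 < k /\ sl2_equiv f (k, 0, k)) then 1 / 2
  else if excluded_middle_informative (exists k : int, 0 < k /\ sl2_equiv f (k, k, k)) then 1 / 3
  else 1.

Definition class_reps (N : nat) (s : seq bqf) : Prop :=
  (forall f, f \in s -> posdef f /\ disc f = - (N%:Z)) /\
  (forall f, posdef f -> disc f = - (N%:Z) -> exists2 g, g \in s & sl2_equiv f g) /\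
  (forall f g, f \in s -> g \in s -> sl2_equiv f g -> f = g).

Definition HurwitzSpec (N : nat) (h : rat) : Prop :=
  if N == 0%N then h = - (1 / 12)
  else if (N %% 4 == 1)%N || (N %% 4 == 2)%N then h = 0
  else exists s : seq bqf, uniq s /\ class_reps N s /\ h = \sum_(f <- s) cls_weight f.

(* Hurwitz class number H(N) (the unique h with HurwitzSpec N h) *)
Definition H (N : nat) : rat := epsilon (inhabits 0) (HurwitzSpec N).

(* Main.v *)
Require Import Defs.
From HB Require Import structures.
From mathcomp Require Import all_boot all_order all_algebra.
From mathcomp Require Import zify ring lra.
From Stdlib Require Import ClassicalEpsilon.
Import Order.TTheory GRing.Theory Num.Theory.
Local Open Scope ring_scope.

(* Idea: a combinatorial Lefschetz fixed point formula for the Hecke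
   correspondence T_p on X_1(7), after Popa and Zagier.

   Fix a unit al mod 7.  If al^2 is not p mod 7, an integral matrix M of
   determinant p satisfies M x = al x or M x = - al x for some nonzero x in F_7^2
   exactly when its trace is s or - s mod 7, where s = al + p / al.  Summing the
   number of such x over the elliptic M, weighted by the position of their
   fixed point in the ideal triangle (0, 1, oo), therefore gives the sums of
   H(4p - r^2) over r = s and r = - s mod 7 ([sum_obtuse], [sum_elliptic]).

   The same sum is computed in a second way.  Pointwise identities between
   piecewise constant functions of M ([merel_S], [meetsE], [driftE],
   [drift_conjU]), each saying how the triangle M(0, 1, oo) lies with respect to
   (0, 1, oo), transform the elliptic matrices into the finite set of Merel's
   Heilbronn matrices, up to left, right and two-sided multiplication by SL_2(Z).
   To exploit these, the diagonal of (F_7^2 - 0)^2 is written as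
   F(x, y) - F(S x, y) + g(x, y) + h(x, y), with F(., y) invariant under T and with
   g(x, .) and h(x, .) invariant under S and U respectively: this is possible
   because X_1(7) has genus 0, so that all modular symbols come from the cusps.
   The contributions of g and h cancel against the other terms, and that of F is a
   sum over upper and lower triangular matrices, which is explicit. *)

(** * Sums over integral matrices of determinant p *)

(** Only the supports have to correspond, so a sum truncated to a finite box can be reindexed
    although the box is not stable under the group action. *)
Lemma big_bij_supp (T T' : eqType) (s : seq T) (t : seq T') (phi : T -> T') (psi : T' -> T)
    (F : T' -> int) : uniq s -> uniq t ->
    (forall x, x \in s -> F (phi x) != 0 -> phi x \in t /\ psi (phi x) = x) ->
    (forall y, y \in t -> F y != 0 -> psi y \in s /\ phi (psi y) = y) ->
  \sum_(x <- s) F (phi x) = \sum_(y <- t) F y.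
Proof.
move=> us ut st ts.
have sub (R : eqType) (u : seq R) (g : R -> int) :
    \sum_(x <- u) g x = \sum_(x <- [seq x <- u | g x != 0]) g x.
  rewrite big_filter [LHS](bigID (fun x => g x != 0)) /= [X in _ + X]big1 ?addr0 // => x.
  by rewrite negbK => /eqP.
rewrite sub [RHS]sub -(big_map phi predT F); apply: perm_big; apply: uniq_perm.
- rewrite map_inj_in_uniq ?filter_uniq // => x y;
    rewrite !mem_filter => /andP[fx sx] /andP[fy sy] e.
  by have [_ <-] := st x sx fx; have [_ <-] := st y sy fy; rewrite e.
- exact: filter_uniq.
move=> y; rewrite mem_filter; apply/mapP/andP => [[x]|[fy ty]].
  by rewrite mem_filter => /andP[fx sx] ->; have [? _] := st x sx fx.
by have [sy e] := ts y ty fy; exists (psi y); rewrite ?e // mem_filter e fy.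
Qed.

Lemma big_reindex_supp (T : eqType) (s : seq T) (P : pred T) (phi psi : T -> T) (f : T -> int) :
  uniq s -> cancel phi psi -> cancel psi phi ->
  {subset s <= P} -> (forall x, P (psi x) = P x) ->
  (forall x, P x -> f x != 0 -> (x \in s) && (psi x \in s)) ->
  \sum_(x <- s) f (phi x) = \sum_(x <- s) f x.
Proof.
move=> us phiK psiK sP Ppsi fs; apply: (big_bij_supp _ _ _ _ phi psi) => // [x|y] /sP Px fx.
  by have /andP[] := fs _ (etrans (esym (Ppsi _)) (etrans (congr1 P (phiK x)) Px)) fx.
by have /andP[] := fs y Px fx.
Qed.

Lemma big_supp_sub (T : eqType) (s L : seq T) (f : T -> int) : uniq s -> uniq L ->
  {subset L <= s} -> (forall x, x \in s -> f x != 0 -> x \in L) ->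
  \sum_(x <- s) f x = \sum_(x <- L) f x.
Proof.
move=> us uL Ls fL; apply: (big_bij_supp _ _ _ _ id id) => // x xs fx; split=> //.
  exact: fL.
exact: Ls.
Qed.

Definition mat : Type := (int * int * int * int)%type.
Definition mul (M N : mat) : mat :=
  let: (a, b, c, d) := M in let: (a', b', c', d') := N in
  (a * a' + b * c', a * b' + b * d', c * a' + d * c', c * b' + d * d').
Definition det (M : mat) : int := let: (a, b, c, d) := M in a * d - b * c.
Definition adj (M : mat) : mat := let: (a, b, c, d) := M in (d, - b, - c, a).
Definition bnd (n : nat) (M : mat) : bool :=
  let: (a, b, c, d) := M in [&& `|a| <= n, `|b| <= n, `|c| <= n & `|d| <= n]%N.

Lemma det_mul M N : det (mul M N) = det M * det N.
Proof. by case: M => [[[a b] c] d]; case: N => [[[a' b'] c'] d'] /=; ring. Qed.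
Lemma det_adj M : det (adj M) = det M.
Proof. by case: M => [[[a b] c] d] /=; ring. Qed.
Lemma mulA M N P : mul M (mul N P) = mul (mul M N) P.
Proof.
case: M => [[[a b] c] d]; case: N => [[[a' b'] c'] d']; case: P => [[[a'' b''] c''] d''] /=.
by congr (_, _, _, _); ring.
Qed.
Lemma adjK M : adj (adj M) = M.
Proof. by case: M => [[[a b] c] d] /=; rewrite !opprK. Qed.
Lemma mul_adjK g M : det g = 1 -> mul (adj g) (mul g M) = M.
Proof.
case: g => [[[a b] c] d]; case: M => [[[a' b'] c'] d'] /= e.
by congr (_, _, _, _); rewrite -[RHS]mul1r -e; ring.
Qed.
Lemma mulK_adj g M : det g = 1 -> mul (mul M g) (adj g) = M.
Proof.
case: g => [[[a b] c] d]; case: M => [[[a' b'] c'] d'] /= e.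
by congr (_, _, _, _); rewrite -[RHS]mulr1 -e; ring.
Qed.

Definition rng (n : nat) : seq int := [seq i%:Z - n%:Z | i <- iota 0 (n.*2).+1].
Lemma rng_uniq n : uniq (rng n).
Proof. by rewrite map_inj_uniq ?iota_uniq // => i j; lia. Qed.
Lemma mem_rng n (x : int) : (x \in rng n) = (`|x| <= n)%N.
Proof.
apply/mapP/idP => [[i]|H]; first by rewrite mem_iota; lia.
by exists (absz (x + n%:Z)%R); rewrite ?mem_iota; lia.
Qed.

Definition pairs (T U : Type) (s : seq T) (t : seq U) := [seq (x, y) | x <- s, y <- t].
Arguments pairs {T U}.
Lemma pairs_uniq (T U : eqType) (s : seq T) (t : seq U) : uniq s -> uniq t -> uniq (pairs s t).
Proof. by move=> us ut; apply: allpairs_uniq => // -[? ?] [? ?]. Qed.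
Lemma mem_pairs (T U : eqType) (s : seq T) (t : seq U) x y :
  ((x, y) \in pairs s t) = (x \in s) && (y \in t).
Proof. by apply/allpairsP/andP => [[[u v] /= [us vt [-> ->]]]|[xs yt]] //; exists (x, y). Qed.

(** A finite stand-in for all integral matrices of determinant p: the functions that occur are
    supported in it once n is large. *)
Definition box (p n : nat) : seq mat :=
  [seq M <- pairs (pairs (pairs (rng n) (rng n)) (rng n)) (rng n) | det M == p%:Z].
Lemma box_uniq p n : uniq (box p n).
Proof. by rewrite filter_uniq // !pairs_uniq ?rng_uniq. Qed.
Lemma mem_box p n M : (M \in box p n) = (det M == p%:Z) && bnd n M.
Proof.
by case: M => [[[a b] c] d]; rewrite mem_filter !mem_pairs !mem_rng -!andbA.
Qed.

(** * The action on F_7^2 and the trace pairing *)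

Notation vec := ('F_7 * 'F_7)%type.
Definition vact (M : mat) (x : vec) : vec :=
  let: (a, b, c, d) := M in (a%:~R * x.1 + b%:~R * x.2, c%:~R * x.1 + d%:~R * x.2).
Definition scal (k : 'F_7) (x : vec) : vec := (k * x.1, k * x.2).

Lemma vact_mul M N x : vact (mul M N) x = vact M (vact N x).
Proof.
case: M => [[[a b] c] d]; case: N => [[[a' b'] c'] d'] /=.
by congr (_, _); rewrite !rmorphD !rmorphM /=; ring.
Qed.
Lemma vact_scal M k x : vact M (scal k x) = scal k (vact M x).
Proof. by case: M => [[[a b] c] d]; congr (_, _); rewrite /=; ring. Qed.
Lemma vact_adjK M x : vact (adj M) (vact M x) = scal (det M)%:~R x.
Proof.
case: M x => [[[a b] c] d] [x y] /=; rewrite /scal /=.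
by congr (_, _); rewrite !rmorphB ?rmorphN !rmorphM /=; ring.
Qed.
Lemma scal1 x : scal 1 x = x. Proof. by case: x => x y; rewrite /scal !mul1r. Qed.
Lemma scal_eq0 k x : (scal k x == 0) = (k == 0) || (x == 0).
Proof.
case: x => x y; rewrite /scal -!pair_eqE /= /pair_eq /= !mulf_eq0.
by case: eqVneq.
Qed.
Lemma vact0 M : vact M 0 = 0.
Proof. by case: M => [[[a b] c] d]; rewrite /vact /= !mulr0 addr0. Qed.
Lemma vact_eq0 M x : (det M)%:~R != 0 :> 'F_7 -> (vact M x == 0) = (x == 0).
Proof.
move=> dM; apply/eqP/eqP => [e|->]; last exact: vact0.
by have := vact_adjK M x; rewrite e vact0 => /esym/eqP; rewrite scal_eq0 (negPf dM) => /eqP.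
Qed.

(* The trace of the operator [sum_M f(M) al^-1 M] on functions on F_7^2 - 0,
   composed with the operator of kernel [K]. *)
Definition pairing (s : seq mat) (al : 'F_7) (f : mat -> int) (K : vec -> vec -> int) : int :=
  \sum_(M <- s) f M * \sum_(x : vec | x != 0) K (scal al x) (vact M x).

Definition supp (p n : nat) (f : mat -> int) := forall M, det M = p -> f M != 0 -> bnd n M.
(** Covers S, U, U^2, T and their inverses; a product with such a matrix at most doubles the bound
    on the entries. *)
Definition small (g : mat) := (det g == 1) && bnd 1 g.

Lemma small_adj g : small g -> small (adj g).
Proof. by rewrite /small det_adj; case: g => [[[a b] c] d] /=; lia. Qed.
Lemma unit_comb_bnd (n : nat) (a b x y : int) : (`|a| <= 1 -> `|b| <= 1 -> `|x| <= n ->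
    `|y| <= n ->
  `|(a * x + b * y)%R| <= n.*2)%N.
Proof.
move=> ha hb hx hy.
have [|[]] : a = 0 \/ a = 1 \/ a = -1 by lia.
all: move=> ->; have [|[]] : b = 0 \/ b = 1 \/ b = -1 by lia.
all: by move=> ->; lia.
Qed.
Lemma bnd_mull n g M : small g -> bnd n M -> bnd (n.*2) (mul g M).
Proof.
move=> /andP[_]; case: g => [[[a b] c] d]; case: M => [[[a' b'] c'] d'] /=.
by case/and4P=> ha hb hc hd /and4P[*]; rewrite !unit_comb_bnd.
Qed.
Lemma bnd_mulr n g M : small g -> bnd n M -> bnd (n.*2) (mul M g).
Proof.
move=> /andP[_]; case: g => [[[a b] c] d]; case: M => [[[a' b'] c'] d'] /=.
case/and4P=> ha hb hc hd /and4P[*].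
by rewrite !(mulrC a') !(mulrC b') !(mulrC c') !(mulrC d') !unit_comb_bnd.
Qed.
Lemma bnd_le m n M : (m <= n)%N -> bnd m M -> bnd n M.
Proof. by case: M => [[[a b] c] d] /=; lia. Qed.

(** Cyclicity of the trace: the substitution N = g M h, with h x for x in the inner sum, moves g and
    h from f to the kernel. Two small factors multiply the entry bound by at most 4, whence
    [4 * m <= n]. *)
Lemma pr_mul p n m al f K g h : small g -> small h -> supp p m f -> (4 * m <= n)%N ->
  pairing (box p n) al (fun M => f (mul (mul g M) h)) K =
  pairing (box p n) al f (fun x y => K (vact h x) (vact (adj g) y)).
Proof.
move=> sg sh sf mn; rewrite /pairing.
have [/eqP dg _] := andP sg; have [/eqP dh _] := andP sh.
pose phi M := mul (mul g M) h; pose psi M := mul (mul (adj g) M) (adj h).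
have phiK : cancel phi psi.
  by move=> M; rewrite /phi /psi -!mulA mul_adjK // mulA mulK_adj //.
have psiK : cancel psi phi.
  move=> M; rewrite /phi /psi -!mulA -{1}[g]adjK mul_adjK ?det_adj // mulA.
  by rewrite -{2}[h]adjK mulK_adj ?det_adj //.
have det_psi M : det (psi M) = det M by rewrite /psi !det_mul !det_adj dg dh mul1r mulr1.
pose kap N := \sum_(x : vec | x != 0) K (vact h (scal al x)) (vact (adj g) (vact N x)).
rewrite (eq_bigr (fun M => f (phi M) * kap (phi M))); last first.
  move=> M _; rewrite /phi; congr (_ * _); rewrite /kap.
  have hK : cancel (vact h) (vact (adj h)).
    by move=> x; rewrite vact_adjK dh scal1.
  have Kh : cancel (vact (adj h)) (vact h).
    by move=> x; have := vact_adjK (adj h) x; rewrite adjK det_adj dh scal1.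
  rewrite (reindex (vact h)); last by exists (vact (adj h)) => x _.
  apply: eq_big => [x|x _]; first by rewrite vact_eq0 // dh oner_eq0.
  by rewrite vact_scal !vact_mul vact_adjK dg scal1.
rewrite (big_reindex_supp _ _ (fun M => det M == p%:Z) phi psi (fun M => f M * kap M)) //.
- exact: box_uniq.
- by move=> M; rewrite mem_box => /andP[].
- by move=> M; rewrite det_psi.
- move=> M /eqP dM; rewrite mulf_eq0 negb_or !mem_box det_psi dM eqxx => /andP[fM _] /=.
  have bM := sf M dM fM.
  rewrite (bnd_le _ _ _ _ bM) /=; last by lia.
  apply: (bnd_le (m.*2.*2)); first by lia.
  by rewrite bnd_mulr ?bnd_mull ?small_adj.
Qed.

Lemma pr_eq p n al f f' K : (forall M, det M = p%:Z -> f M = f' M) ->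
  pairing (box p n) al f K = pairing (box p n) al f' K.
Proof. by move=> e; apply: eq_big_seq => M; rewrite mem_box => /andP[/eqP dM _]; rewrite e. Qed.
Lemma prD s al f f' K : pairing s al (fun M => f M + f' M) K =
    pairing s al f K + pairing s al f' K.
Proof. by rewrite /pairing -big_split; apply: eq_bigr => M _; rewrite mulrDl. Qed.
Lemma prZ s al (k : int) f K : pairing s al (fun M => k * f M) K = k * pairing s al f K.
Proof. by rewrite /pairing mulr_sumr; apply: eq_bigr => M _; rewrite mulrA. Qed.
Lemma prN s al f K : pairing s al (fun M => - f M) K = - pairing s al f K.
Proof. by rewrite /pairing -sumrN; apply: eq_bigr => M _; rewrite mulNr. Qed.
Lemma pr_kerD s al f K K' : pairing s al f (fun x y => K x y + K' x y) =
    pairing s al f K + pairing s al f K'.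
Proof. by rewrite /pairing -big_split; apply: eq_bigr => M _; rewrite big_split mulrDr. Qed.
Lemma pr_kerN s al f K : pairing s al f (fun x y => - K x y) = - pairing s al f K.
Proof. by rewrite /pairing -sumrN; apply: eq_bigr => M _; rewrite sumrN mulrN. Qed.
Lemma pr_ker_eq p n al f K K' : al != 0 -> p%:R != 0 :> 'F_7 ->
    (forall x y, x != 0 -> y != 0 -> K x y = K' x y) ->
  pairing (box p n) al f K = pairing (box p n) al f K'.
Proof.
move=> al0 p0 e; apply: eq_big_seq => M; rewrite mem_box => /andP[/eqP dM _].
by congr (_ * _); apply: eq_bigr => x x0; rewrite e ?vact_eq0 ?scal_eq0 ?negb_or ?al0 // dM.
Qed.

(** * Relative positions of two ideal triangles *)

Definition matS : mat := (0, -1, 1, 0).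
Definition matU : mat := (1, -1, 1, 0).
Definition matU2 : mat := (0, -1, 1, -1).
Definition matT : mat := (1, 1, 0, 1).
Definition b2i (b : bool) : int := (b : nat)%:Z.
(* Opposite signs, strictly or weakly; written with signs only, so that [lia] applies. *)
Definition opp (x y : int) := ((x < 0) && (0 < y)) || ((0 < x) && (y < 0)).
Definition wopp (x y : int) := ((x <= 0) && (0 <= y)) || ((0 <= x) && (y <= 0)).

(* Below, M = (a, b, c, d) acts on the upper half plane, D is the ideal triangle
   (0, 1, oo) and L is its side (0, oo).  All functions are even in M. *)

(* The sides M L of the tessellation by the images of M D that bound, on the
   side Re z < 0, the union of the triangles crossed by L. *)
Definition merel (M : mat) : int := let: (a, b, c, d) := M in
  b2i ([&& b <= 0, c <= 0, 0 < a + b & 0 < c + d] || [&& 0 <= b, 0 <= c, a + b < 0 & c + d < 0]).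
(* M L crosses L. *)
Definition crossing (M : mat) : int := let: (a, b, c, d) := M in b2i (opp a (- d) && opp b c).
(* M L = L, with either orientation. *)
Definition axial (M : mat) : int := let: (a, b, c, d) := M in
  b2i ((b == 0) && (c == 0)) + b2i ((a == 0) && (d == 0)).
(* M L joins oo to a point of (0, 1), that is, joins a vertex of D to the opposite arc. *)
Definition grazing (M : mat) : int := let: (a, b, c, d) := M in
  b2i ((c == 0) && opp b (b - d)) + b2i ((d == 0) && opp a (a - c)).
(* M D is contained in the half plane Re z <= 0. *)
Definition beyond (M : mat) : int := let: (a, b, c, d) := M in
  b2i [&& wopp a c, wopp b d & wopp (a + b) (c + d)].
(* M D meets the interior of D. *)
Definition meets (M : mat) : int := 1 - beyond M - beyond (mul matU M) - beyond (mul matU2 M).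

(* [drift M] is twice the indicator of the fixed point of M (the attracting one if
   M is hyperbolic) being in Re z < 0, with value 1 if it is on L.  If M fixes 0 or oo the
   convention is chosen so that [drift - 2 beyond] has finite support. *)
Definition drift_lt (M : mat) : bool := let: (a, b, c, d) := M in
  if opp b c then opp c (a - d) else opp b (a + d) || opp c (a + d).
Definition drift_le (M : mat) : bool := let: (a, b, c, d) := M in
  if opp b c then opp c (a - d) || (a - d == 0)
  else [|| opp b (a + d), opp c (a + d) | (b == 0) && (c == 0)].
Definition drift (M : mat) : int := b2i (drift_lt M) + b2i (drift_le M).
(** The part of [drift] where M L crosses L; unlike [drift], it has finite support. *)
Definition cdrift (M : mat) : int := let: (a, b, c, d) := M in
  let e := opp a (- d) && opp b c in b2i (e && drift_lt M) + b2i (e && drift_le M).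

(* The contribution to [drift_conjU] of the matrices that fix oo. *)
Definition splitw (M : mat) : int := let: (a, b, c, d) := M in
  let w := a + b - c - d in let t := a + d in
  2 * b2i [&& c == 0, opp b t & opp w (- t)] + b2i [&& c == 0, b == 0 & opp w (- t)]
  + b2i [&& c == 0, w == 0 & opp b t].
(* Twice the indicator of M being elliptic with fixed point in D, counted with
   value 1 on the sides of D.  The conditions are the triangle inequalities
   for the values c, - b, c + d - a - b of the form (c, d - a, - b) at
   (1, 0), (0, 1), (1, 1). *)
Definition ellw (M : mat) : int := let: (a, b, c, d) := M in
  let w := a + b - c - d in
  b2i [&& 0 < c, b < 0, w < 0, 0 <= a - d, 0 <= d - a - b *+ 2 & 0 <= d - a + c *+ 2]
  + b2i [&& 0 < c, b < 0, w < 0, 0 < a - d, 0 < d - a - b *+ 2 & 0 < d - a + c *+ 2]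
  + b2i [&& c < 0, 0 < b, 0 < w, a - d <= 0, d - a - b *+ 2 <= 0 & d - a + c *+ 2 <= 0]
  + b2i [&& c < 0, 0 < b, 0 < w, a - d < 0, d - a - b *+ 2 < 0 & d - a + c *+ 2 < 0].

Lemma mulS a b c d : mul matS (a, b, c, d) = (- c, - d, a, b).
Proof. by congr (_, _, _, _); lia. Qed.
Lemma mulMS a b c d : mul (a, b, c, d) matS = (b, - a, d, - c).
Proof. by congr (_, _, _, _); lia. Qed.
Lemma mulU a b c d : mul matU (a, b, c, d) = (a - c, b - d, a, b).
Proof. by congr (_, _, _, _); lia. Qed.
Lemma mulU2 a b c d : mul matU2 (a, b, c, d) = (- c, - d, a - c, b - d).
Proof. by congr (_, _, _, _); lia. Qed.
Lemma mulMU a b c d : mul (a, b, c, d) matU = (a + b, - a, c + d, - c).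
Proof. by congr (_, _, _, _); lia. Qed.
Lemma conjS a b c d : mul (mul matS (a, b, c, d)) (adj matS) = (d, - c, - b, a).
Proof. by congr (_, _, _, _); lia. Qed.
Lemma conjU a b c d :
  mul (mul matU (a, b, c, d)) (adj matU) = (d - b, a + b - c - d, - b, a + b).
Proof. by congr (_, _, _, _); lia. Qed.
Lemma conjU2 a b c d :
  mul (mul matU2 (a, b, c, d)) (adj matU2) = (c + d, - c, - (a + b - c - d), a - c).
Proof. by congr (_, _, _, _); lia. Qed.

(** S exchanges the ends of L, so M S L = M L. *)
Lemma crossingS M : crossing (mul M matS) = crossing M.
Proof. by case: M => [[[a b] c] d]; rewrite mulMS /crossing /opp /b2i; lia. Qed.
Lemma axialS M : axial (mul M matS) = axial M.
Proof. by case: M => [[[a b] c] d]; rewrite mulMS /axial /b2i; lia. Qed.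
Lemma grazingS M : grazing (mul M matS) = grazing M.
Proof. by case: M => [[[a b] c] d]; rewrite mulMS /grazing /opp /b2i; lia. Qed.
(** U permutes the vertices 0, 1, oo of D, so M U D = M D. *)
Lemma beyondU M : beyond (mul M matU) = beyond M.
Proof.
case: M => [[[a b] c] d]; rewrite mulMU /beyond; congr b2i.
have -> : a + b - a = b by lia.
have -> : c + d - c = d by lia.
have -> : wopp (- a) (- c) = wopp a c by rewrite /wopp; lia.
by rewrite andbC -andbA.
Qed.
Lemma meetsU M : meets (mul M matU) = meets M.
Proof. by rewrite /meets !mulA !beyondU. Qed.

(** If M L crosses L, then the fixed points of M have product - b / c > 0 and lie on the same side
    of L; conjugation by S exchanges the two sides. *)
Lemma cdrift_conjS M : cdrift M + cdrift (mul (mul matS M) (adj matS)) = 2 * crossing M.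
Proof.
case: M => [[[a b] c] d]; rewrite conjS /cdrift /crossing /drift_lt /drift_le /opp /b2i.
rewrite !(oppr_lt0, oppr_gt0).
case: (ltrgtP a 0)=>Ha; case: (ltrgtP b 0)=> Hb; case: (ltrgtP c 0)=> Hc; case: (ltrgtP d 0)=> Hd.
all: by rewrite /=; lia.
Qed.

(** The terms in [beyond] detect whether L cuts the interior of M D. If it does, the side M L either
    crosses L or stays in one of the two half planes, where it bounds the union of the cut
    triangles. The last term corrects the case M L = L. *)
Lemma merel_S M : 0 < det M ->
  merel M + merel (mul matS M) = 1 - beyond M - beyond (mul matS M) - crossing M + axial M.
Proof.
case: M => [[[a b] c] d]; rewrite mulS /det => H.
rewrite /merel /crossing /axial /beyond /opp /wopp /b2i.
rewrite !(oppr_lt0, oppr_gt0, oppr_le0, oppr_ge0, oppr_eq0).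
case: (ltrgtP a 0)=>Ha; case: (ltrgtP b 0)=> Hb; case: (ltrgtP c 0)=> Hc;
    case: (ltrgtP d 0)=> Hd; subst.
all: try (by exfalso; nia).
all: rewrite /=; try lia.
all: nia.
Qed.

(** Neither [drift] nor [beyond] has finite support; the right side shows that this combination of
    them has. *)
Lemma driftE M : 0 < det M -> drift M - 2 * beyond M = 2 * merel M - axial M + cdrift M.
Proof.
case: M => [[[a b] c] d]; rewrite /det => H.
rewrite /cdrift /drift /drift_lt /drift_le /beyond /merel /axial /wopp /opp /b2i.
rewrite !(oppr_lt0, oppr_gt0).
case: (ltrgtP a 0)=>Ha; case: (ltrgtP b 0)=> Hb; case: (ltrgtP c 0)=> Hc;
    case: (ltrgtP d 0)=> Hd; subst.
all: try (by exfalso; nia).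
all: rewrite /=; try lia.
all: nia.
Qed.

Ltac prune := try (exfalso; lia).
Ltac sgn x := let H := fresh in case: (ltrgtP x 0)=> H; prune.

Lemma meetsE M : 0 < det M ->
  2 * meets M = 2 * (merel M + merel (mul matU M) + merel (mul matU2 M))
    + (crossing M + crossing (mul matU M) + crossing (mul matU2 M))
    + (grazing M + grazing (mul matU M) + grazing (mul matU2 M)).
Proof.
case: M => [[[a b] c] d]; rewrite /det /meets mulU mulU2 => H.
rewrite /grazing.
have -> : b - d - b = - d by lia.
have -> : a - c - a = - c by lia.
have -> : - d - (b - d) = - b by lia.
have -> : - c - (a - c) = - a by lia.
rewrite /beyond /merel /crossing.
have -> : - c - d = - (c + d) by lia.
(* Once the linear forms are named, their signs become cases of their own. A consistent sign pattern
   is settled by evaluation; any other contradicts the positive determinant. *)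
have [k Hk] : exists k, k = a - c + (b - d) by eexists.
have [e He] : exists e, e = a - c by eexists.
have [f Hf] : exists f, f = b - d by eexists.
have [g Hg] : exists g, g = a + b by eexists.
have [h Hh] : exists h, h = c + d by eexists.
rewrite -Hk -He -Hf -Hg -Hh.
rewrite /wopp /opp !(oppr_lt0, oppr_gt0, oppr_le0, oppr_ge0, oppr_eq0).
case: (ltrgtP a 0)=>Ha; case: (ltrgtP b 0)=> Hb; case: (ltrgtP c 0)=> Hc; case: (ltrgtP d 0)=> Hd.
all: try (by exfalso; nia).
all: sgn e; sgn f.
all: sgn g; sgn h; sgn k.
all: try by [].
all: exfalso; nia.
Qed.

(** Conjugation by U rotates the three half planes outside D. For elliptic M the left side thus
    locates the fixed point in D. A non-elliptic M is hyperbolic, as the determinant is not a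
    square, and its attracting fixed point lies in one of the three arcs; [splitw] corrects the case
    where a vertex is fixed. *)
Lemma drift_conjU M : 1 < det M -> (forall x, det M <> x * x) ->
  2 - drift M - drift (mul (mul matU M) (adj matU)) - drift (mul (mul matU2 M) (adj matU2)) =
  ellw M - splitw M - splitw (mul (mul matU M) (adj matU)) - splitw (mul (mul matU2 M) (adj
      matU2)).
Proof.
case: M => [[[a b] c] d]; rewrite conjU conjU2 /det => H Hs.
have Had : a = d -> b = 0 \/ c = 0 -> False.
  by move=> ad bc; apply: (Hs a); case: bc => bc; subst; lia.
have [w Hw] : exists w, w = a + b - c - d by eexists.
have [t Ht] : exists t, t = a + d by eexists.
have [e He] : exists e, e = a - d by eexists.
have [f Hf] : exists f, f = d - a - b *+ 2 by eexists.
have [g Hg] : exists g, g = d - a + c *+ 2 by eexists.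
rewrite /drift /drift_lt /drift_le /splitw /ellw -Hw.
have -> : d - b + (a + b) = t by lia.
have -> : c + d + (a - c) = t by lia.
have -> : d - b - (a + b) = f by lia.
have -> : c + d - (a - c) = g by lia.
have -> : d - b + w - - b - (a + b) = - c by lia.
have -> : c + d + - c - - w - (a - c) = b by lia.
rewrite -Ht -He -Hf -Hg.
rewrite /opp !(oppr_lt0, oppr_gt0, oppr_le0, oppr_ge0, oppr_eq0).
case: (ltrgtP b 0)=> Hb; case: (ltrgtP c 0)=> Hc; case: (ltrgtP w 0)=> Hw0;
    case: (ltrgtP t 0) => Ht0.
all: prune.
all: try (by exfalso; nia).
all: try by [].
all: sgn e; sgn f.
all: sgn g.
all: try by [].
all: exfalso; nia.
Qed.

(** * Finite supports *)

Lemma factor_bnd (p : nat) (x y z : int) : x * y + z = p -> 0 <= z -> 0 < x * y ->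
    (`|x| <= p)%N && (`|y| <= p)%N.
Proof.
move=> e z0 xy; have [x0 y0] : x <> 0 /\ y <> 0 by nia.
have Hx : (`|x| <= `|x| * `|y|)%N by nia.
have Hy : (`|y| <= `|x| * `|y|)%N by nia.
have : (`|x| * `|y|)%N = `|(x * y)%R|%N by rewrite abszM.
by lia.
Qed.
Lemma merel_supp p : supp p p merel.
Proof.
move=> [[[a b] c] d] /=; rewrite /b2i => D H.
have {H} : [&& b <= 0, c <= 0, 0 < a + b & 0 < c + d] ||
    [&& 0 <= b, 0 <= c, a + b < 0 & c + d < 0] by move: H; case: (_ || _).
by case/orP=> /and4P[Hb Hc H1 H2]; apply/and4P; split; nia.
Qed.
Lemma crossing_supp p : supp p p crossing.
Proof.
move=> [[[a b] c] d] /=; rewrite /b2i => D.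
case: andP => // -[H1 H2] _; move: H1 H2; rewrite /opp !(oppr_lt0, oppr_gt0).
case/orP=> /andP[? ?]; case/orP=> /andP[? ?].
all: have D' : - b * c + a * d = p by rewrite -D; ring.
all: have /andP[-> ->] := factor_bnd p a d (- (b * c)) D ltac:(nia) ltac:(nia).
all: have /andP[] := factor_bnd p (- b) c (a * d) D' ltac:(nia) ltac:(nia).
all: by rewrite abszN => -> ->.
Qed.
Lemma axial_supp p : (0 < p)%N -> supp p p axial.
Proof.
move=> p0 [[[a b] c] d] /=; rewrite /b2i => D H.
have : (b == 0) && (c == 0) || (a == 0) && (d == 0) by move: H; do 2!case: (_ && _).
case/orP=> /andP[/eqP ? /eqP ?]; subst.
  by have /andP[-> ->] := factor_bnd p a d 0 ltac:(lia) ltac:(lia) ltac:(lia).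
by have /andP[] := factor_bnd p (- b) c 0 ltac:(lia) ltac:(lia) ltac:(lia);
    rewrite abszN => -> ->.
Qed.
Lemma grazing_supp p : (0 < p)%N -> supp p p grazing.
Proof.
move=> p0 [[[a b] c] d] /=; rewrite /b2i => D H.
have : (c == 0) && opp b (b - d) || (d == 0) && opp a (a - c).
  by move: H; case: (_ && opp b _); case: (_ && opp a _).
rewrite /opp; case/orP=> /andP[/eqP ? Hb]; subst.
  by have /andP[-> Hd] := factor_bnd p a d 0 ltac:(lia) ltac:(lia) ltac:(lia); lia.
by have /andP[] := factor_bnd p (- b) c 0 ltac:(lia) ltac:(lia) ltac:(lia); lia.
Qed.
Lemma cdrift_supp p : supp p p cdrift.
Proof.
move=> M D H; apply: crossing_supp => //; move: H; case: M {D} => [[[a b] c] d].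
by rewrite /cdrift /crossing; case: (opp a _ && opp b c).
Qed.
Lemma splitw_supp p : (0 < p)%N -> supp p (p.*2) splitw.
Proof.
move=> p0 [[[a b] c] d] /=; rewrite /b2i => D H.
have : (c == 0) && [|| opp b (a + d) && opp (a + b - c - d) (- (a + d)),
  (b == 0) | (a + b - c - d == 0)].
  by move: H; case: (c == 0) => //=; case: (opp b _); case: (opp (_ - d) _); case: (b == 0);
      case: (a + b - c - d == 0).
rewrite /opp; case/andP=> [/eqP c0]; subst.
have /andP[Ha Hd] := factor_bnd p a d 0 ltac:(lia) ltac:(lia) ltac:(lia).
by lia.
Qed.

(** * The kernels on F_7^2 *)

(* A solution, found by computer, of the linear system [kerh_U], [kerh_S],
   [kerh_sum], [kerg_S] in the values of F and h, multiplied by 12.  All kernels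
   satisfy K(k x, k y) = K(x, y) for k in F_7^*, so x is normalized: the two
   lists for F are the cusps x = (1, 0) and x = (., 1), and the rows for h are
   x = (1, 0), ..., (1, 6), (0, 1).  Entry 7 i + j is the value at y = (i, j). *)
Definition cuspA : seq int := (
  [:: 0; -12; 0; 0; 0; 0; -12; 0; 0; 0; 0; -4; -4; 0; 0; 0; 0; 0; 0; 0; 0; 0; 0; 0; 0; 0; 0; 0; 0;
  0; 0; 0; 0; 0; 0; 0; 0; 0; 0; 0; 0; 0; 0; 0; -4; -4; 0; 0; 0])%Z.
Definition cuspB : seq int := (
  [:: 0; 0; 0; 0; 0; 0; 0; 0; 0; 0; 0; 0; -8; 0; 0; 0; 0; -4; 0; 0; 0; 0; 0; 0; 0; 0; 0; 0; 0; 0;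
  0; 0; 0; 0; 0; 0; 0; 0; 0; -4; 0; 0; 0; 0; -8; 0; 0; 0; 0])%Z.
Definition tabh : seq (seq int) := ([::
  [:: 0; 1; 1; 1; 1; 1; 1; 1; 1; 1; 1; 1; -3; 1; 1; 1; 1; -3; 1; 1; 1; 1; -3; 1; 1; 1; 1; 1; 1;
    1; 1; 1; 1; 1; -3; 1; 1; 1; 1; -3; 1; 1; 1; 1; -3; 1; 1; 1; 1];
  [:: 0; 11; -1; -1; -1; -1; 11; 11; 11; -1; -1; -1; -1; -1; -1; -1; -1; -1; -1; -1; -1; -1; -1;
    -1; -1; -1; -1; -1; -1; -1; -1; -1; -1; -1; -1; -1; -1; -1; -1; -1; -1; -1; 11; -1; -1; -1;
    -1; -1; 11];
  [:: 0; 9; -3; -3; -3; -3; 9; 9; 9; 9; -3; -3; 1; 9; -3; 9; -3; 1; -3; -3; -3; -3; 1; -3; -3;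
    -3; -3; -3; -3; -3; -3; -3; -3; -3; 1; -3; -3; -3; -3; 1; -3; 9; 9; 9; 1; -3; -3; 9; 9];
  [:: 0; 4; 4; -8; -8; 4; 4; 4; 4; 4; 4; -8; 0; 4; 4; 4; 4; 0; 4; 4; 4; -8; 0; 4; -8; -8; 4; -8;
    -8; -8; 4; -8; -8; 4; 0; 4; 4; 4; 4; 0; 4; 4; 4; 4; 0; -8; 4; 4; 4];
  [:: 0; 1; 1; 1; 1; 1; 1; 1; 1; 1; 1; 1; -3; 1; 1; 1; 1; -3; 1; 1; 1; 1; -3; 1; 1; 1; 1; 1; 1;
    1; 1; 1; 1; 1; -3; 1; 1; 1; 1; -3; 1; 1; 1; 1; -3; 1; 1; 1; 1];
  [:: 0; 0; 0; 0; 0; 0; 0; 0; 0; 0; 0; 0; 4; 0; 0; 0; 0; 4; 0; 0; 0; 0; 4; 0; 0; 0; 0; 0; 0; 0;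
    0; 0; 0; 0; 4; 0; 0; 0; 0; 4; 0; 0; 0; 0; 4; 0; 0; 0; 0];
  [:: 0; -10; 2; 2; 2; 2; -10; -10; -10; 2; 2; 2; 2; 2; 2; 2; 2; 2; 2; 2; 2; 2; 2; 2; 2; 2; 2;
    2; 2; 2; 2; 2; 2; 2; 2; 2; 2; 2; 2; 2; 2; 2; -10; 2; 2; 2; 2; 2; -10];
  [:: 0; 0; 0; 0; 0; 0; 0; 0; 0; 0; 0; 0; 4; 0; 0; 0; 0; 4; 0; 0; 0; 0; 4; 0; 0; 0; 0; 0; 0; 0;
    0; 0; 0; 0; 4; 0; 0; 0; 0; 4; 0; 0; 0; 0; 4; 0; 0; 0; 0]])%Z.

Definition entry (s : seq int) (y : vec) : int := nth 0 s (7 * y.1 + y.2)%N.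
Definition lead (x : vec) : 'F_7 := if x.1 == 0 then x.2 else x.1.
Definition line (x : vec) : nat := if x.1 == 0 then 7 else val (x.2 / x.1).
Definition kerF (x y : vec) : int :=
  if x.2 == 0 then entry cuspA (scal x.1^-1 y) else entry cuspB (scal x.2^-1 y).
Definition kerh (x y : vec) : int := entry (nth [::] tabh (line x)) (scal (lead x)^-1 y).
Definition delta (x y : vec) : int := b2i (y == x) + b2i (y == - x).
Definition kerg (x y : vec) : int := 12 * delta x y - (kerF x y - kerF (vact matS x) y) - kerh
    x y.

Lemma scal_scal k l x : scal k (scal l x) = scal (k * l) x.
Proof. by rewrite /scal /= !mulrA. Qed.
Lemma scal_inj k : k != 0 -> injective (scal k).
Proof.
move=> k0 x y /(congr1 (scal k^-1)).
by rewrite !scal_scal mulVf // !scal1.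
Qed.
Lemma scalN k x : scal k (- x) = - scal k x.
Proof. by case: x => x y; rewrite /scal /= !mulrN. Qed.
Lemma lead_eq0 x : (lead x == 0) = (x == 0).
Proof. by case: x => x y; rewrite /lead -pair_eqE /pair_eq /=;
    case: (eqVneq x 0) => [//|/negPf]. Qed.

Lemma kerF_scal (k : 'F_7) x y : k != 0 -> kerF (scal k x) (scal k y) = kerF x y.
Proof.
move=> k0; rewrite /kerF /= mulf_eq0 (negPf k0) /= !scal_scal !invfM.
by do 2!rewrite mulrAC mulVf // mul1r.
Qed.
Lemma lead_scal (k : 'F_7) x : k != 0 -> lead (scal k x) = k * lead x.
Proof. by move=> k0; rewrite /lead [(scal k x).1]/(k * x.1) mulf_eq0 (negPf k0); case: eqP. Qed.
Lemma line_scal (k : 'F_7) x : k != 0 -> line (scal k x) = line x.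
Proof.
move=> k0; rewrite /line [(scal k x).1]/(k * x.1) [(scal k x).2]/(k * x.2) mulf_eq0 (negPf k0).
by rewrite invfM mulrACA divff // mul1r.
Qed.
Lemma kerh_scal (k : 'F_7) x y : k != 0 -> kerh (scal k x) (scal k y) = kerh x y.
Proof.
move=> k0; rewrite /kerh line_scal // lead_scal // scal_scal.
by rewrite invfM mulrAC mulVf // mul1r.
Qed.
Lemma delta_scal (k : 'F_7) x y : k != 0 -> delta (scal k x) (scal k y) = delta x y.
Proof. by move=> k0; rewrite /delta -scalN !(inj_eq (scal_inj _ k0)). Qed.
Lemma kerg_scal (k : 'F_7) x y : k != 0 -> kerg (scal k x) (scal k y) = kerg x y.
Proof. by move=> k0; rewrite /kerg vact_scal delta_scal // !kerF_scal // kerh_scal. Qed.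

Definition elts : seq 'F_7 := [:: inZp 0; inZp 1; inZp 2; inZp 3; inZp 4; inZp 5; inZp 6].
Lemma mem_elts x : x \in elts.
Proof. by case: x => [[|[|[|[|[|[|[|m]]]]]]] Hm]; rewrite !inE. Qed.
Definition vecs : seq vec := pairs elts elts.
Lemma mem_vecs y : y \in vecs.
Proof. by case: y => y z; rewrite mem_pairs !mem_elts. Qed.
Definition lines : seq vec := (0, 1) :: [seq (1, t) | t <- elts].

(** Invariance under simultaneous scaling allows x to be normalized to one of eight vectors, which
    leaves a finite computation. *)
Lemma check_all (P : vec -> vec -> bool) :
    (forall k x y, k != 0 -> P (scal k x) (scal k y) = P x y) ->
    all (fun x => all (fun y => (y == 0) || P x y) vecs) lines ->
  forall x y, x != 0 -> y != 0 -> P x y.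
Proof.
move=> Psc /allP H x y x0 y0.
have k0 : (lead x)^-1 != 0 by rewrite invr_eq0 lead_eq0.
rewrite -(Psc (lead x)^-1) //.
suff /H/allP/(_ (scal (lead x)^-1 y) (mem_vecs _)) : scal (lead x)^-1 x \in lines.
  by rewrite scal_eq0 (negPf k0) (negPf y0).
move: k0; rewrite invr_eq0 /lead /scal; case: x {x0} => x z.
rewrite /fst /snd; case: (eqVneq x 0) => [->|x0] z0.
  by rewrite mulr0 mulVf // inE eqxx.
by rewrite mulVf // inE map_f ?orbT // mem_elts.
Qed.

Lemma kerh_U x y : x != 0 -> y != 0 -> kerh x (vact matU y) == kerh x y.
Proof.
apply: (check_all (fun x y => kerh x (vact matU y) == kerh x y)) x y.
  by move=> k x y k0; rewrite vact_scal !kerh_scal.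
by vm_compute.
Qed.
Lemma kerh_S x y : x != 0 -> y != 0 -> kerh x y + kerh (vact matS x) y == 1.
Proof.
apply: (check_all (fun x y => kerh x y + kerh (vact matS x) y == 1)) x y.
  by move=> k x y k0; rewrite vact_scal !kerh_scal.
by vm_compute.
Qed.
Lemma kerh_sum x y : x != 0 -> y != 0 -> kerh x y + kerh (vact matU x) y + kerh (vact matU2 x) y
  == 12 * (delta x y + delta (vact matU x) y + delta (vact matU2 x) y).
Proof.
apply: (check_all (fun x y => kerh x y + kerh (vact matU x) y + kerh (vact matU2 x) y
  == 12 * (delta x y + delta (vact matU x) y + delta (vact matU2 x) y))) x y.
  by move=> k x y k0; rewrite !vact_scal !kerh_scal // !delta_scal.
by vm_compute.
Qed.
Lemma kerg_S x y : x != 0 -> y != 0 -> kerg x (vact matS y) == kerg x y.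
Proof.
apply: (check_all (fun x y => kerg x (vact matS y) == kerg x y)) x y.
  by move=> k x y k0; rewrite vact_scal !kerg_scal.
by vm_compute.
Qed.
(** The terms in F cancel, because S^2 = -1 and F is even; what remains is [kerh_S]. *)
Lemma kerg_SE x y : x != 0 -> y != 0 ->
  kerg x y + kerg (vact matS x) y + 1 == 12 * (delta x y + delta (vact matS x) y).
Proof.
apply: (check_all (fun x y => kerg x y + kerg (vact matS x) y + 1 == 12 * (delta x y +
    delta (vact matS x) y))) x y.
  by move=> k x y k0; rewrite !vact_scal !kerg_scal // !delta_scal.
by vm_compute.
Qed.
(** As U = T S and F is invariant under T, F(U x, y) = F(S x, y). The terms in F therefore telescope
    along x, U x, U^2 x, and the rest is [kerh_sum]. *)
Lemma kerg_sum x y : x != 0 -> y != 0 ->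
    kerg x y + kerg (vact matU x) y + kerg (vact matU2 x) y == 0.
Proof.
apply: (check_all (fun x y => kerg x y + kerg (vact matU x) y + kerg (vact matU2 x) y == 0)) x y.
  by move=> k x y k0; rewrite !vact_scal !kerg_scal.
by vm_compute.
Qed.
Lemma kerF_even x y : x != 0 -> y != 0 -> kerF x (- y) == kerF x y.
Proof.
apply: (check_all (fun x y => kerF x (- y) == kerF x y)) x y.
  by move=> k x y k0; rewrite -scalN !kerF_scal.
by vm_compute.
Qed.
Lemma kerF_shift (k : 'F_7) x y : kerF (x.1 + k * x.2, x.2) y = kerF x y.
Proof.
rewrite /kerF /fst /snd; case: x => x z; case: (eqVneq z 0) => [->|//].
by rewrite mulr0 addr0.
Qed.

(** * The trace formula *)

Lemma vact1 x : vact (1, 0, 0, 1) x = x.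
Proof. by case: x => x y; rewrite /vact /fst /snd !mul1r !mul0r addr0 add0r. Qed.
Lemma vact_adj g x : det g = 1 -> vact g (vact (adj g) x) = x.
Proof. by move=> dg; have := vact_adjK (adj g) x; rewrite adjK det_adj dg scal1. Qed.
Lemma mul1m M : mul (1, 0, 0, 1) M = M.
Proof. by case: M => [[[a b] c] d]; congr (_, _, _, _); lia. Qed.
Lemma mulm1 M : mul M (1, 0, 0, 1) = M.
Proof. by case: M => [[[a b] c] d]; congr (_, _, _, _); lia. Qed.
Lemma small1 : small (1, 0, 0, 1). Proof. by []. Qed.

Lemma supp_le p m n f : (m <= n)%N -> supp p m f -> supp p n f.
Proof. by move=> mn sf M dM fM; apply: bnd_le mn (sf M dM fM). Qed.
Lemma supp_add p m f f' : supp p m f -> supp p m f' -> supp p m (fun M => f M + f' M).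
Proof.
move=> sf sf' M dM; case: (eqVneq (f M) 0) => [->|fM _]; last exact: sf.
by rewrite add0r; apply: sf'.
Qed.
Lemma supp_scale p m k f : supp p m f -> supp p m (fun M => k * f M).
Proof. by move=> sf M dM; rewrite mulf_eq0 negb_or => /andP[_]; apply: sf. Qed.
Lemma supp_mull p m g f : small g -> supp p m f -> supp p m.*2 (fun M => f (mul g M)).
Proof.
move=> sg sf M dM fM; have [/eqP dg _] := andP sg.
rewrite -(mul_adjK g M dg) bnd_mull ?small_adj // sf // det_mul dg.
by rewrite mul1r.
Qed.
Lemma supp_eq p m f f' : (forall M, det M = p%:Z -> f M = f' M) -> supp p m f -> supp p m f'.
Proof. by move=> e sf M dM; rewrite -e //; apply: sf. Qed.

Definition ker_one (x y : vec) : int := 1.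
Definition pullback (g : mat) (K : vec -> vec -> int) (x y : vec) : int := K (vact g x) y.

Section Pairing.
Variables (p n : nat) (al : 'F_7).
Hypotheses (al0 : al != 0) (p0 : p%:R != 0 :> 'F_7).
Local Notation "<< f , K >>" := (pairing (box p n) al f K) (at level 0).

Lemma pr_left m f K g : small g -> supp p m f -> (4 * m <= n)%N ->
  (forall x y, x != 0 -> y != 0 -> K x (vact g y) == K x y) ->
  << fun M => f (mul g M), K >> = << f, K >>.
Proof.
move=> sg sf mn Kg; have [/eqP dg _] := andP sg.
rewrite (pr_eq _ _ _ _ (fun M => f (mul (mul g M) (1, 0, 0, 1)))); last first.
  by move=> M _; rewrite mulm1.
rewrite (pr_mul _ _ _ _ _ _ _ _ sg small1 sf mn).
apply: pr_ker_eq => // x y x0 y0; rewrite vact1 -(eqP (Kg _ _ _ _)) ?vact_adj //.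
by rewrite vact_eq0 // det_adj dg oner_eq0.
Qed.

Lemma pr_right m f K h : small h -> supp p m f -> (4 * m <= n)%N ->
  << fun M => f (mul M h), K >> = << f, pullback h K >>.
Proof.
move=> sh sf mn.
rewrite (pr_eq _ _ _ _ (fun M => f (mul (mul (1, 0, 0, 1) M) h))); last first.
  by move=> M _; rewrite mul1m.
rewrite (pr_mul _ _ _ _ _ _ _ _ small1 sh sf mn).
by apply: pr_ker_eq => // x y x0 y0; rewrite /pullback; congr (K _ _); rewrite -[RHS]vact1.
Qed.

Lemma pr_conj m f K g : small g -> supp p m f -> (4 * m <= n)%N ->
  (forall x y, K (vact g x) (vact g y) = K x y) ->
  << fun M => f (mul (mul g M) (adj g)), K >> = << f, K >>.
Proof.
move=> sg sf mn Kg; have [/eqP dg _] := andP sg.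
rewrite (pr_mul _ _ _ _ _ _ _ _ sg (small_adj _ sg) sf mn).
by apply: pr_ker_eq => // x y _ _; rewrite -Kg !vact_adj.
Qed.

Lemma delta_vact g x y : det g = 1 -> delta (vact g x) (vact g y) = delta x y.
Proof.
move=> dg; have inj : injective (vact g).
  by apply: (can_inj (g := vact (adj g))) => z; rewrite vact_adjK dg scal1.
have actN z : vact g (- z) = - vact g z.
  have scalN1 w : - w = scal (-1) w by case: w => u v; rewrite /scal !mulN1r.
  by rewrite !scalN1 vact_scal.
by rewrite /delta -actN !(inj_eq inj).
Qed.

Lemma pr_right_inv m f K h : small h -> supp p m f -> (4 * m <= n)%N ->
    (forall M, det M = p%:Z -> f (mul M h) = f M) ->
  << f, pullback h K >> = << f, K >>.
Proof. by move=> sh sf mn fh; rewrite -(pr_right m) //; apply: pr_eq. Qed.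

Hypotheses (pn : (100 * p <= n)%N) (p_gt1 : (1 < p)%N) (p_nsq : forall x : int, p%:Z <> x * x).
Let detP M : det M = p%:Z -> 0 < det M. Proof. by move=> ->; lia. Qed.
Let sS : small matS. Proof. by []. Qed.
Let sU : small matU. Proof. by []. Qed.
Let sU2 : small matU2. Proof. by []. Qed.
Let smerel : supp p p merel := merel_supp p.
Let scross : supp p p crossing := crossing_supp p.
Let sax : supp p p axial. Proof. by apply: axial_supp; lia. Qed.
Let sgr : supp p p grazing. Proof. by apply: grazing_supp; lia. Qed.
Let ssp : supp p p.*2 splitw. Proof. by apply: splitw_supp; lia. Qed.
Let mn m : (m <= 20 * p)%N -> (4 * m <= n)%N. Proof. by lia. Qed.

Lemma pr_ker0 f K : (forall x y, x != 0 -> y != 0 -> K x y = 0) -> << f, K >> = 0.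
Proof.
move=> K0; rewrite (pr_ker_eq _ _ _ _ _ (fun _ _ => 0)) //.
by rewrite /pairing big1 // => M _; rewrite big1 ?mulr0.
Qed.
Lemma pr_kerZ k f K : << f, fun x y => k * K x y >> = k * << f, K >>.
Proof.
by rewrite /pairing mulr_sumr; apply: eq_bigr => M _; rewrite -mulr_sumr mulrCA.
Qed.

(** A right U-invariant function pairs equally with the pullbacks of g along 1, U and U^2, and these
    add up to zero. *)
Lemma pr_Uinv_g m f : supp p m f -> (4 * m <= n)%N ->
  (forall M, det M = p%:Z -> f (mul M matU) = f M) -> << f, kerg >> = 0.
Proof.
move=> sf mn' fU.
have fU2 M : det M = p%:Z -> f (mul M matU2) = f M.
  by move=> dM; rewrite -(fU _ dM) -(fU (mul M matU)) ?det_mul ?dM ?mulr1 // -mulA.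
have := pr_ker0 f (fun x y => kerg x y + pullback matU kerg x y + pullback matU2 kerg x y).
rewrite (pr_kerD _ _ _ (fun x y => kerg x y + pullback matU kerg x y) (pullback matU2 kerg)).
rewrite (pr_kerD _ _ _ kerg) (pr_right_inv m _ _ matU) // (pr_right_inv m _ _ matU2) // => H.
have {}H := H _; suff: << f, kerg >> + << f, kerg >> + << f, kerg >> = 0 by lia.
by apply: H => x y x0 y0; apply/eqP; apply: kerg_sum.
Qed.

Lemma pr_Sinv_g m f : supp p m f -> (4 * m <= n)%N ->
    (forall M, det M = p%:Z -> f (mul M matS) = f M) ->
  2 * << f, kerg >> = 24 * << f, delta >> - << f, ker_one >>.
Proof.
move=> sf mn' fS.
have : << f, fun x y => (kerg x y + pullback matS kerg x y) + ker_one x y >> =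
       << f, fun x y => 12 * (delta x y + pullback matS delta x y) >>.
  by apply: pr_ker_eq => // x y x0 y0; apply/eqP; apply: kerg_SE.
rewrite pr_kerZ (pr_kerD _ _ _ (fun x y => kerg x y + pullback matS kerg x y) ker_one).
rewrite (pr_kerD _ _ _ kerg) (pr_kerD _ _ _ delta).
by rewrite (pr_right_inv m _ kerg matS) // (pr_right_inv m _ delta matS) //; lia.
Qed.

Lemma pr_Sinv_h m f : supp p m f -> (4 * m <= n)%N ->
    (forall M, det M = p%:Z -> f (mul M matS) = f M) ->
  2 * << f, kerh >> = << f, ker_one >>.
Proof.
move=> sf mn' fS.
have : << f, fun x y => kerh x y + pullback matS kerh x y >> = << f, ker_one >>.
  by apply: pr_ker_eq => // x y x0 y0; apply/eqP; apply: kerh_S.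
by rewrite (pr_kerD _ _ _ kerh) (pr_right_inv m _ kerh matS) //; lia.
Qed.

Lemma pr_Uinv_h m f : supp p m f -> (4 * m <= n)%N ->
    (forall M, det M = p%:Z -> f (mul M matU) = f M) ->
  << f, kerh >> = 12 * << f, delta >>.
Proof.
move=> sf mn' fU.
have fU2 M : det M = p%:Z -> f (mul M matU2) = f M.
  by move=> dM; rewrite -(fU _ dM) -(fU (mul M matU)) ?det_mul ?dM ?mulr1 // -mulA.
have : << f, fun x y => (kerh x y + pullback matU kerh x y) + pullback matU2 kerh x y >> =
       << f, fun x y => 12 * ((delta x y + pullback matU delta x y) +
           pullback matU2 delta x y) >>.
  by apply: pr_ker_eq => // x y x0 y0; apply/eqP; apply: kerh_sum.
rewrite pr_kerZ (pr_kerD _ _ _ (fun x y => kerh x y +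
    pullback matU kerh x y) (pullback matU2 kerh)).
rewrite (pr_kerD _ _ _ (fun x y => delta x y + pullback matU delta x y) (pullback matU2 delta)).
rewrite (pr_kerD _ _ _ kerh) (pr_kerD _ _ _ delta).
rewrite !(pr_right_inv m _ kerh matU, pr_right_inv m _ delta matU,
  pr_right_inv m _ kerh matU2, pr_right_inv m _ delta matU2) //.
by lia.
Qed.

(** The combination [Y] has finite support by construction and, by [merel_S], is right invariant
    under U; hence it pairs to zero with g. Left S-invariance of g merges its two [merel] terms, and
    [pr_Sinv_g] evaluates the terms in [crossing] and [axial]. *)
Lemma pr_merel_g : 4 * << merel, kerg >> =
  24 * << axial, delta >> - << axial, ker_one >> - 24 * << crossing, delta >> +
      << crossing, ker_one >>.
Proof.
pose Y M := merel M + merel (mul matS M) + crossing M + (-1) * axial M.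
have YE M : det M = p%:Z -> Y M = 1 - beyond M - beyond (mul matS M).
  by move=> /detP dM; rewrite /Y (merel_S _ dM); lia.
have sY : supp p p.*2 Y.
  have l : (p <= p.*2)%N by lia.
  do !apply: supp_add; first exact: (supp_le _ _ _ _ l smerel).
  - exact: supp_mull.
  - exact: (supp_le _ _ _ _ l scross).
  - by apply: supp_scale; exact: (supp_le _ _ _ _ l sax).
have YU M : det M = p%:Z -> Y (mul M matU) = Y M.
  by move=> dM; rewrite !YE ?det_mul ?dM ?mulr1 // mulA !beyondU.
have := pr_Uinv_g _ Y sY (mn p.*2 ltac:(lia)) YU.
have -> : << Y, kerg >> = 2 * << merel, kerg >> + << crossing, kerg >> - << axial, kerg >>.
  rewrite /Y !prD prZ (pr_left p _ _ matS) //; first by lia.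
    by apply: mn; lia.
  by move=> x y x0 y0; apply: kerg_S.
have := pr_Sinv_g p _ scross (mn p ltac:(lia)) (fun M _ => crossingS M).
have := pr_Sinv_g p _ sax (mn p ltac:(lia)) (fun M _ => axialS M).
by lia.
Qed.

(** By [meetsE], [W] is right U-invariant, and left U-invariance of h makes the three terms of each
    triple equal. The functions [crossing] and [grazing] are right S-invariant, so [pr_Sinv_h]
    reduces them to a constant kernel. *)
Lemma pr_merel_h : 12 * << merel, kerh >> =
  48 * << meets, delta >> - 3 * << crossing, ker_one >> - 3 * << grazing, ker_one >>.
Proof.
pose W M := 2 * (merel M + merel (mul matU M) + merel (mul matU2 M))
    + (crossing M + crossing (mul matU M) + crossing (mul matU2 M))
    + (grazing M + grazing (mul matU M) + grazing (mul matU2 M)).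
have WE M : det M = p%:Z -> 2 * meets M = W M by move=> /detP dM; rewrite meetsE.
have l : (p <= p.*2)%N by lia.
have sW : supp p p.*2 (fun M => 2 * meets M).
{ apply: (supp_eq _ _ W) => [M dM|]; first by rewrite WE.
  rewrite /W; do !apply: supp_add; first (apply: supp_scale; do !apply: supp_add).
  all: try by apply: supp_mull.
  all: by apply: (supp_le _ _ _ _ l). }
have WU M : det M = p%:Z -> 2 * meets (mul M matU) = 2 * meets M by rewrite meetsU.
have := pr_Uinv_h _ _ sW (mn p.*2 ltac:(lia)) WU.
rewrite (pr_eq _ _ _ _ _ kerh WE) /W prZ.
have hU x y : x != 0 -> y != 0 -> kerh x (vact matU y) == kerh x y by apply: kerh_U.
have hU2 x y : x != 0 -> y != 0 -> kerh x (vact matU2 y) == kerh x y.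
  move=> x0 y0; rewrite (_ : matU2 = mul matU matU) // vact_mul.
  by rewrite (eqP (hU _ _ _ _)) ?vact_eq0 ?oner_eq0 // hU.
have m4 : (4 * p <= n)%N by lia.
rewrite !prD prZ !prD !(pr_left p _ _ matU) // !(pr_left p _ _ matU2) //.
have := pr_Sinv_h p _ scross m4 (fun M _ => crossingS M).
have := pr_Sinv_h p _ sgr m4 (fun M _ => grazingS M).
by lia.
Qed.

Lemma beyond_adjU M : beyond (mul M (adj matU)) = beyond M.
Proof. by rewrite -[LHS]beyondU -{2}[matU]adjK mulK_adj. Qed.
Lemma beyond_adjU2 M : beyond (mul M (adj matU2)) = beyond M.
Proof.
rewrite -[LHS]beyondU -[LHS]beyondU -mulA (_ : mul matU matU = matU2) //.
by rewrite -{2}[matU2]adjK mulK_adj.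
Qed.

(** Since [delta] is invariant under the diagonal action, conjugate functions have equal pairings.
    Twice [beyond] is subtracted from each [drift] in [drift_conjU], which makes every term finitely
    supported and produces [meets]. *)
Lemma pr_drift :
  << ellw, delta >> = 2 * << meets, delta >> + 3 * << splitw, delta >>
   - 6 * << merel, delta >> + 3 * << axial, delta >> - 3 * << crossing, delta >>.
Proof.
pose b M := 2 * merel M + (-1) * axial M + cdrift M.
have bE M : det M = p%:Z -> drift M - 2 * beyond M = b M.
  by move=> /detP dM; rewrite driftE // /b; lia.
have sc := cdrift_supp p.
have sb : supp p p b.
  by do !apply: supp_add => //; apply: supp_scale.
have m4 : (4 * p <= n)%N by lia.
have m8 : (4 * p.*2 <= n)%N by lia.
pose cj g M := mul (mul g M) (adj g).
have conj f m g : small g -> supp p m f -> (4 * m <= n)%N ->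
    << fun M => f (cj g M), delta >> = << f, delta >>.
  move=> sg sf mn'; apply: (pr_conj m) => // x y.
  by have [/eqP dg _] := andP sg; exact: delta_vact.
have det_cj g M : small g -> det (cj g M) = det M.
  by case/andP=> /eqP dg _; rewrite !det_mul det_adj dg mul1r mulr1.
have hc : << cdrift, delta >> = << crossing, delta >>.
  have : << fun M => cdrift M + cdrift (cj matS M), delta >> =
      << fun M => 2 * crossing M, delta >>.
    by apply: pr_eq => M _; apply: cdrift_conjS.
  by rewrite prD prZ (conj _ p) //; lia.
have hb : << b, delta >> = 2 * << merel, delta >> - << axial, delta >> + << crossing, delta >>.
  by rewrite /b !prD !prZ hc; lia.
clearbody b.
suff : << fun M => b M + b (cj matU M) + b (cj matU2 M), delta >> =
    << fun M => 2 * meets M + (-1) * ellw M + (splitw M + splitw (cj matU M) +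
        splitw (cj matU2 M)), delta >>.
  by move=> H; rewrite !prD !prZ !(conj b p) // !(conj splitw p.*2) // hb in H; lia.
apply: pr_eq => M dM; rewrite -!bE ?det_cj //.
have := drift_conjU M; rewrite dM => /(_ p_gt1 p_nsq).
rewrite /cj !beyond_adjU !beyond_adjU2 /meets.
by lia.
Qed.

(** When [12 * delta] is written as F(x, y) - F(S x, y) + g + h, all terms in [meets] and
    [crossing], and the pairing of [axial] with [delta], cancel. *)
Lemma pr_trace : 24 * << ellw, delta >> =
  72 * << splitw, delta >> - 12 * << merel, fun x y => kerF x y - pullback matS kerF x y >>
  + 3 * << axial, ker_one >> + 3 * << grazing, ker_one >>.
Proof.
have : << merel, fun x y => (kerF x y - pullback matS kerF x y) + kerg x y + kerh x y >> =
    << merel, fun x y => 12 * delta x y >>.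
  by apply: pr_ker_eq => // x y _ _; rewrite /kerg /pullback; lia.
rewrite pr_kerZ (pr_kerD _ _ _ (fun x y => (kerF x y - pullback matS kerF x y) + kerg x y) kerh).
rewrite (pr_kerD _ _ _ (fun x y => kerF x y - pullback matS kerF x y) kerg).
by move: pr_drift pr_merel_g pr_merel_h; lia.
Qed.
End Pairing.

(** * Contributions of the cusps *)

(** The crossings of L by M L with M oo < 0 < M 0. *)
Definition wedge (M : mat) : int := let: (a, b, c, d) := M in
  b2i ([&& 0 < a, c < 0, 0 < b & 0 < d] || [&& a < 0, 0 < c, b < 0 & d < 0]).
(** The names [lower] and [upper] refer to the entry that vanishes: [lower] lives on upper
    triangular matrices, [upper] on lower triangular ones. *)
Definition lower (M : mat) : int := if M.1.2 == 0 then merel M else 0.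
Definition upper (M : mat) : int := if M.1.1.2 == 0 then merel M else 0.

Lemma mulMT a b c d : mul (a, b, c, d) matT = (a, a + b, c, c + d).
Proof. by congr (_, _, _, _); lia. Qed.

(** The difference of the two [wedge] terms is a coboundary for T, which dies against the
    T-invariant F; only triangular matrices survive. *)
Lemma merel_shift M : 0 < det M ->
  merel M - merel (mul M matU) = wedge (mul M matT) - wedge M + lower M - upper (mul M matU).
Proof.
case: M => [[[a b] c] d]; rewrite mulMT mulMU /upper /lower /det /= => H.
rewrite /merel /wedge.
have -> : a + b - a = b by lia.
have -> : c + d - c = d by lia.
have [g Hg] : exists g, g = a + b by eexists.
have [h Hh] : exists h, h = c + d by eexists.
rewrite -Hg -Hh !(oppr_lt0, oppr_gt0, oppr_le0, oppr_ge0, oppr_eq0).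
case: (ltrgtP a 0)=>Ha; case: (ltrgtP b 0)=> Hb; case: (ltrgtP c 0)=> Hc; case: (ltrgtP d 0)=> Hd.
all: try (by exfalso; nia).
all: sgn g; sgn h.
all: try by [].
all: exfalso; nia.
Qed.

Lemma sum_iota_lt (k N : nat) : (k <= N)%N -> \sum_(i <- iota 0 N) b2i (i < k)%N = k%:Z.
Proof.
move=> kN; rewrite -(subnKC kN) iotaD big_cat /=.
rewrite [X in _ + X]big1_seq ?addr0 => [|i]; last by rewrite mem_iota /b2i; lia.
rewrite (eq_big_seq (fun=> 1)) => [|i]; last by rewrite mem_iota /b2i; lia.
by rewrite big_const_seq count_predT size_iota iter_addr_0 natz.
Qed.

Lemma sum_rng_lt (n : nat) (k : int) : - n%:Z <= k <= n%:Z + 1 ->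
  \sum_(b <- rng n) b2i (b < k) = k + n%:Z.
Proof.
move=> kn; rewrite /rng big_map.
rewrite (eq_bigr (fun i : nat => b2i (i < absz (k + n%:Z)%R)%N)) => [|i _]; last by congr b2i;
    lia.
by rewrite sum_iota_lt; lia.
Qed.

Lemma sum_rng_itv (n : nat) (l r : int) : - n%:Z <= l -> l <= r -> r <= n%:Z + 1 ->
  \sum_(b <- rng n) b2i (l <= b < r) = r - l.
Proof.
move=> nl lr rn; rewrite (eq_bigr (fun b => b2i (b < r) - b2i (b < l))); last first.
  by move=> b _; rewrite /b2i; lia.
by rewrite sumrB !sum_rng_lt; lia.
Qed.

Lemma prime_factor (p : nat) (a d : int) : prime p -> a * d = p%:Z ->
  [|| (a == p%:Z) && (d == 1), (a == - p%:Z) && (d == -1), (a == 1) && (d == p%:Z) |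
   (a == -1) && (d == - p%:Z)].
Proof.
move=> pp e; have p1 := prime_gt1 pp.
have : (`|a| %| p)%N by apply/dvdnP; exists `|d|%N; rewrite -[p]/(absz p) -e abszM mulnC.
have [_ pdiv] := primeP pp; case/pdiv/orP=> /eqP ha.
  have [a1|a1] : a = 1 \/ a = -1 by lia.
    by subst a; lia.
  by subst a; lia.
have [a1|a1] : a = p%:Z \/ a = - p%:Z by lia.
  have d1 : d = 1 by nia.
  by subst; lia.
have d1 : d = -1 by nia.
by subst; lia.
Qed.

(** For p prime, a triangular matrix of determinant p has one of four diagonals. *)
Definition diag_list (p : nat) (f : int -> int -> int -> mat) : seq mat :=
  [seq f p%:Z b 1 | b <- rng p] ++ [seq f (- p%:Z) b (-1) | b <- rng p] ++
  [seq f 1 b p%:Z | b <- rng p] ++ [seq f (-1) b (- p%:Z) | b <- rng p].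
Definition up (a b d : int) : mat := (a, b, 0, d).
Definition low (a c d : int) : mat := (a, 0, c, d).

Lemma diag_list_uniq p f : prime p ->
    (forall a b d a' b' d', f a b d = f a' b' d' -> [/\ a = a', b = b' & d = d']) ->
  uniq (diag_list p f).
Proof.
move=> /prime_gt1 p1 finj.
have u a d : uniq [seq f a b d | b <- rng p].
  by rewrite map_inj_uniq ?rng_uniq // => b b' /finj[].
have dj a d a' d' : a != a' -> has (mem [seq f a b d | b <- rng p]) [seq f a' b d' | b <- rng
    p] = false.
  move=> aa; apply/hasP => -[M /mapP[b _ ->] /mapP[b' _ /finj[e]]].
  by rewrite e eqxx in aa.
rewrite /diag_list !cat_uniq !has_cat !u !dj //; lia.
Qed.

Lemma mem_diag_list p f a b d : prime p -> (`|b| <= p)%N -> a * d = p%:Z ->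
    f a b d \in diag_list p f.
Proof.
move=> pp bp /(prime_factor _ _ _ pp); rewrite !mem_cat.
by case/or4P=> /andP[/eqP-> /eqP->]; rewrite map_f ?orbT // mem_rng.
Qed.

Lemma sum_diag_list (p n : nat) f (g : mat -> int) : prime p -> (p <= n)%N -> f = up \/ f = low ->
    (forall M, det M = p%:Z -> g M != 0 -> exists a b d, M = f a b d /\ (`|b| <= p)%N) ->
  \sum_(M <- box p n) g M = \sum_(b <- rng p) (g (f p%:Z b 1) + g (f (- p%:Z) b (-1)) +
    g (f 1 b p%:Z) + g (f (-1) b (- p%:Z))).
Proof.
move=> pp pn ff gsupp; have p1 := prime_gt1 pp.
have det_f a b d : det (f a b d) = a * d by case: ff => ->; rewrite /det /=; ring.
have bnd_f a b d : bnd n (f a b d) = [&& `|a| <= n, `|b| <= n & `|d| <= n]%N.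
  by case: ff => ->; rewrite /bnd /=; lia.
rewrite (big_supp_sub _ _ (diag_list p f) _ (box_uniq p n)).
- by rewrite /diag_list !big_cat !big_map /= -!big_split /=; apply: eq_bigr => b _; ring.
- by apply: diag_list_uniq => // a b d a' b' d'; case: ff => -> [-> -> ->].
- move=> M; rewrite /diag_list mem_box !mem_cat.
  by case/or4P; case/mapP=> b; rewrite mem_rng => bp ->; rewrite det_f bnd_f; lia.
- move=> M; rewrite mem_box => /andP[/eqP dM _] /(gsupp _ dM)[a [b [d [e bp]]]].
  by rewrite e mem_diag_list // -(det_f a b d) -e.
Qed.

Lemma sum_ker_one (al : 'F_7) M : \sum_(x : vec | x != 0) ker_one (scal al x) (vact M x) = 48.
Proof. by rewrite sumr_const cardC1 card_prod !card_ord. Qed.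

Lemma pr_one s al f : pairing s al f ker_one = 48 * \sum_(M <- s) f M.
Proof. by rewrite /pairing mulr_sumr; apply: eq_bigr => M _; rewrite sum_ker_one mulrC. Qed.

Section Boundary.
Variables (p n : nat) (al : 'F_7).
Hypotheses (pp : prime p) (al0 : al != 0) (p0 : p%:R != 0 :> 'F_7) (pn : (100 * p <= n)%N).
Local Notation "<< f , K >>" := (pairing (box p n) al f K) (at level 0).
Let p1 : (1 < p)%N := prime_gt1 pp.
Let pn1 : (p <= n)%N. Proof. by lia. Qed.
Let m4 : (4 * p <= n)%N. Proof. by lia. Qed.
Let sS : small matS. Proof. by []. Qed.
Let sU : small matU. Proof. by []. Qed.
Let sT : small matT. Proof. by []. Qed.

Lemma sum_itv_rng (k l r : int) (P : int -> int) : - p%:Z <= l -> l <= r -> r <= p%:Z + 1 ->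
  (forall b, P b = k * b2i (l <= b < r)) -> \sum_(b <- rng p) P b = k * (r - l).
Proof.
move=> pl lr rp PE; rewrite (eq_bigr (fun b => k * b2i (l <= b < r))) => [|b _]; last exact: PE.
by rewrite -mulr_sumr sum_rng_itv.
Qed.

Lemma axial_one : << axial, ker_one >> = 48 * 8.
Proof.
pose ax (M : mat) := b2i ((M.1.1.2 == 0) && (M.1.2 == 0)).
have sax : supp p p ax.
  by move=> [[[a b] c] d] dM h; apply: axial_supp => //; [lia|move: h;
      rewrite /axial /ax /b2i /=; lia].
(* Right multiplication by S turns the antidiagonal matrices into diagonal ones. *)
have -> : << axial, ker_one >> = << fun M => ax M + ax (mul M matS), ker_one >>.
  by apply: pr_eq => -[[[a b] c] d] _; rewrite mulMS /axial /ax /b2i /=; lia.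
rewrite prD (pr_right _ _ _ _ _ p) // (_ : pullback matS ker_one = ker_one) // pr_one.
suff -> : \sum_(M <- box p n) ax M = 4 by [].
rewrite (sum_diag_list p n up) //; last 2 first.
- by left.
- move=> [[[a b] c] d] dM; rewrite /ax /= => h; exists a, b, d.
  by have [-> ->] : b = 0 /\ c = 0 by move: h; rewrite /b2i; lia.
by rewrite (sum_itv_rng 4 0 1) => [|||| b]; rewrite /ax /up /b2i /=; lia.
Qed.

Lemma grazing_one : << grazing, ker_one >> = 48 * (4 * (p%:Z - 1)).
Proof.
pose gz (M : mat) := let: (a, b, c, d) := M in b2i ((c == 0) && opp b (b - d)).
have sgz : supp p p gz.
  move=> [[[a b] c] d] dM h; apply: grazing_supp => //; first by lia.
  by move: h; rewrite /grazing /gz /b2i; lia.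
have -> : << grazing, ker_one >> = << fun M => gz M + gz (mul M matS), ker_one >>.
  by apply: pr_eq => -[[[a b] c] d] _; rewrite mulMS /grazing /gz /opp /b2i; lia.
rewrite prD (pr_right _ _ _ _ _ p) // (_ : pullback matS ker_one = ker_one) // pr_one.
suff -> : \sum_(M <- box p n) gz M = 2 * (p%:Z - 1) by ring.
rewrite (sum_diag_list p n up) //; last 2 first.
- by left.
- move=> [[[a b] c] d] dM h; exists a, b, d; have := sgz _ dM h.
  by have -> : c = 0 by [move: h; rewrite /gz /b2i; lia|]; case/and4P.
rewrite /gz /up big_split /= [X in _ + X](sum_itv_rng 1 (1 - p%:Z) 0); first last.
  by move=> b; rewrite /opp /b2i; lia.
  all: try by lia.
rewrite (sum_itv_rng 1 1 p%:Z) => [|||| b]; rewrite /opp /b2i; lia.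
Qed.

(** The weights add up to 2 (p - 1) over each of the diagonals (p, 1) and (-p, -1), and to 0 over
    the other two. *)
Lemma splitw_sum (K : vec -> vec -> int) (X : int) :
    (forall M, det M = p%:Z -> M.1.2 = 0 ->
        \sum_(x : vec | x != 0) K (scal al x) (vact M x) = X) ->
  << splitw, K >> = 4 * (p%:Z - 1) * X.
Proof.
move=> KX; have c0 M : splitw M != 0 -> M.1.2 = 0.
  by case: M => [[[a b] c] d]; rewrite /splitw /b2i /=; lia.
have -> : << splitw, K >> = (\sum_(M <- box p n) splitw M) * X.
  rewrite /pairing mulr_suml; apply: eq_big_seq => M; rewrite mem_box => /andP[/eqP dM _].
  by case: (eqVneq (splitw M) 0) => [->|/c0 M0]; rewrite ?mul0r // KX.
congr (_ * _); rewrite (sum_diag_list p n up) //; last 2 first.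
- by left.
- move=> [[[a b] c] d] dM h; exists a, b, d; have := c0 _ h; rewrite /= => c00; split;
    first by rewrite c00.
  have := prime_factor p a d pp; rewrite c00 /det in dM h; rewrite mulr0 subr0 in dM => /(_ dM) H.
  move: h; rewrite /splitw /opp /b2i.
  by case/or4P: H => /andP[/eqP-> /eqP->]; lia.
have oppP x t : 0 < t -> (opp x t = (x < 0)) * (opp x (- t) = (0 < x)).
  by move=> t0; split; rewrite /opp; lia.
have e1 b : splitw (up p b 1) =
    2 * b2i (2 - p%:Z <= b < 0) + b2i (0 <= b < 1) + b2i (1 - p%:Z <= b < 2 - p%:Z).
  by rewrite /splitw /up !(oppP _ (p%:Z + 1)) /b2i; lia.
have e2 b : splitw (up (- p%:Z) b (-1)) =
    2 * b2i (1 <= b < p%:Z - 1) + b2i (0 <= b < 1) + b2i (p%:Z - 1 <= b < p%:Z).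
  rewrite /splitw /up (_ : - p%:Z + -1 = - (p%:Z + 1)) ?opprK; last by lia.
  by rewrite !(oppP _ (p%:Z + 1)) /b2i; lia.
have e3 b : splitw (up 1 b p) = 0.
  by rewrite /splitw /up !(oppP _ (1 + p%:Z)) /b2i; lia.
have e4 b : splitw (up (-1) b (- p%:Z)) = 0.
  rewrite /splitw /up (_ : -1 - p%:Z = - (1 + p%:Z)) ?opprK; last by lia.
  by rewrite !(oppP _ (1 + p%:Z)) /b2i; lia.
rewrite (eq_bigr (fun b => 2 * b2i (2 - p%:Z <= b < 0) + b2i (0 <= b < 1)
   + b2i (1 - p%:Z <= b < 2 - p%:Z) +
   (2 * b2i (1 <= b < p%:Z - 1) + b2i (0 <= b < 1) + b2i (p%:Z - 1 <= b < p%:Z)))); last first.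
  by move=> b _; rewrite e1 e2 e3 e4 !addr0.
by rewrite !big_split /= -!mulr_sumr !sum_rng_itv; lia.
Qed.
End Boundary.

(** The inner sum for a triangular matrix with diagonal (a, d); [sum_up] and [sum_low] show that the
    off-diagonal entry does not matter. *)
Definition cuspsum (al a d : 'F_7) : int :=
  \sum_(x : vec | x != 0) kerF (scal al x) (a * x.1, d * x.2).
Definition cuspsum' (al a d : 'F_7) : int :=
  \sum_(x : vec | x != 0) kerF (vact matS (scal al x)) (a * x.1, d * x.2).

Lemma vact_S x : vact matS x = (- x.2, x.1).
Proof. by case: x => x y; rewrite /vact /matS /fst /snd; congr (_, _); ring. Qed.
Lemma vact_U x : vact matU x = (x.1 - x.2, x.1).
Proof. by case: x => x y; rewrite /vact /matU /fst /snd; congr (_, _); ring. Qed.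
Lemma kerF_US x y : kerF (vact matU x) y = kerF (vact matS x) y.
Proof.
rewrite -(kerF_shift 1 (vact matS x)) vact_U vact_S /fst /snd; congr (kerF (_, _) _).
by case: x => x z; ring.
Qed.
Lemma kerF_T x y : kerF (vact matT x) y = kerF x y.
Proof.
rewrite -(kerF_shift 1 x); congr kerF.
by case: x => x z; rewrite /vact /matT /fst /snd; congr (_, _); ring.
Qed.

Section Cusps.
Variables (p n : nat) (al : 'F_7).
Hypotheses (pp : prime p) (al0 : al != 0) (p0 : p%:R != 0 :> 'F_7) (pn : (100 * p <= n)%N).
Local Notation "<< f , K >>" := (pairing (box p n) al f K) (at level 0).
Let p1 : (1 < p)%N := prime_gt1 pp.
Let pn1 : (p <= n)%N. Proof. by lia. Qed.
Let m4 : (4 * p <= n)%N. Proof. by lia. Qed.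
Let sS : small matS. Proof. by []. Qed.
Let sU : small matU. Proof. by []. Qed.
Let sT : small matT. Proof. by []. Qed.
Let smerel := merel_supp p.

Let swedge : supp p p wedge.
Proof.
move=> M dM h; apply: crossing_supp => //; move: h; case: M {dM} => [[[a b] c] d].
by rewrite /wedge /crossing /opp /b2i; lia.
Qed.
Let slower : supp p p lower.
Proof. by move=> M dM; rewrite /lower; case: ifP => [_|_ /eqP//]; exact: smerel _ dM. Qed.
Let supper : supp p p upper.
Proof. by move=> M dM; rewrite /upper; case: ifP => [_|_ /eqP//]; exact: smerel _ dM. Qed.

Lemma pr_merel_cusp :
  << merel, fun x y => kerF x y - pullback matS kerF x y >> =
      << lower, kerF >> - << upper, pullback matS kerF >>.
Proof.
have US f : << f, pullback matU kerF >> = << f, pullback matS kerF >>.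
  by apply: pr_ker_eq => // x y _ _; apply: kerF_US.
rewrite (pr_kerD _ _ _ kerF) pr_kerN -US -(pr_right _ _ _ _ _ p) //.
rewrite -prN -prD.
rewrite (pr_eq _ _ _ _ (fun M => wedge (mul M matT) + (- wedge M) + lower M +
    (- upper (mul M matU)))); last first.
  by move=> M dM; rewrite merel_shift // dM; lia.
rewrite !prD !prN (pr_right _ _ _ _ _ p) // (pr_right _ _ _ _ _ p upper) // US.
have -> : << wedge, pullback matT kerF >> = << wedge, kerF >>.
  by apply: pr_ker_eq => // x y _ _; apply: kerF_T.
by rewrite subrr add0r.
Qed.

Let bij_shear1 (k : 'F_7) : bijective (fun x : vec => (x.1 + k * x.2, x.2)).
Proof.
exists (fun x => (x.1 - k * x.2, x.2)) => -[x y]; rewrite /fst /snd; congr (_, _); ring.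
Qed.
Let bij_shear2 (k : 'F_7) : bijective (fun x : vec => (x.1, x.2 + k * x.1)).
Proof.
exists (fun x => (x.1, x.2 - k * x.1)) => -[x y]; rewrite /fst /snd; congr (_, _); ring.
Qed.

(** A shear of x, under which F is invariant, absorbs b. *)
Lemma sum_up (a b d : 'F_7) : a != 0 ->
  \sum_(x : vec | x != 0) kerF (scal al x) (a * x.1 + b * x.2, d * x.2) = cuspsum al a d.
Proof.
move=> a0; rewrite /cuspsum [RHS](reindex (fun x : vec => (x.1 + b / a * x.2, x.2))); last first.
  by apply: onW_bij.
apply: eq_big => [[x y]|[x y] _]; rewrite /fst /snd.
  rewrite -!pair_eqE /pair_eq /=; case: (eqVneq y 0) => [->|_]; last by rewrite !andbF.
  by rewrite mulr0 addr0.
rewrite /scal /fst /snd.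
have <- := kerF_shift (- (b / a)) (al * (x + b / a * y), al * y).
rewrite /fst /snd.
have -> : al * (x + b / a * y) + - (b / a) * (al * y) = al * x.
  by rewrite mulrDr mulNr (mulrCA al) addrK.
by rewrite mulrDr mulrA mulrCA divff // mulr1.
Qed.
Lemma sum_low (a c d : 'F_7) : d != 0 ->
  \sum_(x : vec | x != 0) kerF (vact matS (scal al x)) (a * x.1, c * x.1 + d * x.2) =
      cuspsum' al a d.
Proof.
move=> d0; rewrite /cuspsum' [RHS](reindex (fun x : vec => (x.1, x.2 + c / d * x.1))); last first.
  by apply: onW_bij.
apply: eq_big => [[x y]|[x y] _]; rewrite /fst /snd.
  rewrite -!pair_eqE /pair_eq /=; case: (eqVneq x 0) => [->|_] //.
  by rewrite mulr0 addr0.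
rewrite !vact_S /scal /fst /snd.
have <- := kerF_shift (c / d) (- (al * (y + c / d * x)), al * x).
rewrite /fst /snd.
have -> : - (al * (y + c / d * x)) + c / d * (al * x) = - (al * y).
  by rewrite mulrDr opprD -addrA (mulrCA al) addNr addr0.
by rewrite mulrDr addrC mulrA mulrCA divff // mulr1.
Qed.

Lemma cuspsumN a d : a != 0 -> d != 0 -> cuspsum al (- a) (- d) = cuspsum al a d.
Proof.
move=> a0 d0; apply: eq_bigr => -[x y] xy; rewrite /fst /snd.
have -> : (- a * x, - d * y) = - (a * x, d * y) :> vec by congr (_, _); rewrite mulNr.
apply/eqP/kerF_even; first by rewrite scal_eq0 negb_or al0.
by move: xy; rewrite -!pair_eqE /pair_eq /= !mulf_eq0 (negPf a0) (negPf d0).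
Qed.
Lemma cuspsumN' a d : a != 0 -> d != 0 -> cuspsum' al (- a) (- d) = cuspsum' al a d.
Proof.
move=> a0 d0; apply: eq_bigr => -[x y] xy; rewrite /fst /snd.
have -> : (- a * x, - d * y) = - (a * x, d * y) :> vec by congr (_, _); rewrite mulNr.
apply/eqP/kerF_even; first by rewrite vact_eq0 ?oner_eq0 // scal_eq0 negb_or al0.
by move: xy; rewrite -!pair_eqE /pair_eq /= !mulf_eq0 (negPf a0) (negPf d0).
Qed.

Let kap (K : vec -> vec -> int) (M : mat) := \sum_(x : vec | x != 0) K (scal al x) (vact M x).

Let kap_up (a b d : int) : a%:~R != 0 :> 'F_7 -> kap kerF (up a b d) = cuspsum al a%:~R d%:~R.
Proof.
move=> a0; rewrite -(sum_up _ b%:~R) // /kap; apply: eq_bigr => -[x y] _.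
by rewrite /vact /up /fst /snd mul0r add0r.
Qed.
Let kap_low (a c d : int) : d%:~R != 0 :> 'F_7 ->
    kap (pullback matS kerF) (low a c d) = cuspsum' al a%:~R d%:~R.
Proof.
move=> a0; rewrite -(sum_low _ c%:~R) // /kap; apply: eq_bigr => -[x y] _.
by rewrite /vact /low /pullback /fst /snd mul0r addr0.
Qed.

Let s1 : \sum_(b <- rng p) b2i (1 - p%:Z <= b < 1) = p. Proof. by rewrite sum_rng_itv; lia. Qed.
Let s2 : \sum_(b <- rng p) b2i (0 <= b < p%:Z) = p. Proof. by rewrite sum_rng_itv; lia. Qed.
Let s3 : \sum_(b <- rng p) b2i (0 <= b < 1) = 1. Proof. by rewrite sum_rng_itv; lia. Qed.

Lemma merel_cusp : << merel, fun x y => kerF x y - pullback matS kerF x y >> =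
  2 * (p%:Z * (cuspsum al p%:R 1 - cuspsum' al 1 p%:R) +
      (cuspsum al 1 p%:R - cuspsum' al p%:R 1)).
Proof.
rewrite pr_merel_cusp.
have N0 (x : 'F_7) : (- x != 0) = (x != 0) by rewrite oppr_eq0.
have o0 := oner_neq0 'F_7.
have -> : << lower, kerF >> = 2 * (p%:Z * cuspsum al p%:R 1 + cuspsum al 1 p%:R).
  rewrite /pairing (sum_diag_list p n up) //; last 2 first.
  - by left.
  - move=> M dM; rewrite mulf_eq0 negb_or => /andP[h _]; have hb := slower _ dM h; move: hb h.
    case: M dM => [[[a b] c] d] dM /and4P[_ bp _ _]; rewrite /lower /=.
    by case: ifP => [/eqP->|_ /eqP//] _; exists a, b, d.
  (* For each sign, the diagonal (p, 1) allows p values of b and the diagonal (1, p) only b = 0. *)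
  rewrite (eq_bigr (fun b : int => cuspsum al p%:R 1 * (b2i (1 - p%:Z <= b < 1) +
      b2i (0 <= b < p%:Z))
     + cuspsum al 1 p%:R * (b2i (0 <= b < 1) + b2i (0 <= b < 1)))); last first.
    move=> b _; rewrite -!/(kap _ _) !kap_up ?rmorphN /= ?N0 // !cuspsumN //.
    have -> : lower (up p%:Z b 1) = b2i (1 - p%:Z <= b < 1) by rewrite /lower /= /b2i; lia.
    have -> : lower (up (- p%:Z) b (-1)) = b2i (0 <= b < p%:Z) by rewrite /lower /= /b2i; lia.
    have -> : lower (up 1 b p%:Z) = b2i (0 <= b < 1) by rewrite /lower /= /b2i; lia.
    have -> : lower (up (-1) b (- p%:Z)) = b2i (0 <= b < 1) by rewrite /lower /= /b2i; lia.
    by ring.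
  rewrite big_split /= -!mulr_sumr !big_split /= s1 s2 s3. by ring.
have -> : << upper, pullback matS kerF >> = 2 * (p%:Z * cuspsum' al 1 p%:R + cuspsum' al p%:R 1).
  rewrite /pairing (sum_diag_list p n low) //; last 2 first.
  - by right.
  - move=> M dM; rewrite mulf_eq0 negb_or => /andP[h _]; have hb := supper _ dM h; move: hb h.
    case: M dM => [[[a b] c] d] dM /and4P[_ _ cp _]; rewrite /upper /=.
    by case: ifP => [/eqP->|_ /eqP//] _; exists a, c, d.
  rewrite (eq_bigr (fun c : int => cuspsum' al p%:R 1 * (b2i (0 <= c < 1) + b2i (0 <= c < 1))
     + cuspsum' al 1 p%:R * (b2i (1 - p%:Z <= c < 1) + b2i (0 <= c < p%:Z)))); last first.
    move=> b _; rewrite -!/(kap _ _) !kap_low ?rmorphN /= ?N0 // !cuspsumN' //.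
    have -> : upper (low p%:Z b 1) = b2i (0 <= b < 1) by rewrite /upper /= /b2i; lia.
    have -> : upper (low (- p%:Z) b (-1)) = b2i (0 <= b < 1) by rewrite /upper /= /b2i; lia.
    have -> : upper (low 1 b p%:Z) = b2i (1 - p%:Z <= b < 1) by rewrite /upper /= /b2i; lia.
    have -> : upper (low (-1) b (- p%:Z)) = b2i (0 <= b < p%:Z) by rewrite /upper /= /b2i; lia.
    by ring.
  rewrite big_split /= -!mulr_sumr !big_split /= s1 s2 s3. by ring.
by ring.
Qed.
End Cusps.

(** * Counting eigenvectors *)

Lemma kernel_line (e f g h : 'F_7) (x : vec) : (e, f) != 0 -> e * h - f * g = 0 ->
  (e * x.1 + f * x.2 == 0) && (g * x.1 + h * x.2 == 0) = [exists k, x == scal k (- f, e)].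
Proof.
move=> ef D; case: x => x y; rewrite /fst /snd; apply/andP/existsP.
  case=> /eqP E1 _; case: (eqVneq e 0) => [e0|e0].
    have f0 : f != 0 by move: ef; rewrite e0 -pair_eqE /pair_eq /=.
    exists (- x / f); rewrite /scal /fst /snd -pair_eqE /pair_eq /=.
    rewrite e0 mul0r add0r in E1; move/eqP: E1; rewrite mulf_eq0 (negPf f0) => /eqP ->.
    by apply/andP; split; [apply/eqP; field | rewrite e0 mulr0].
  exists (y / e); rewrite /scal /fst /snd -pair_eqE /pair_eq /= mulfVK // eqxx andbT.
  apply/eqP/(mulfI e0); move/eqP: E1; rewrite addr_eq0 => /eqP ->.
  by rewrite mulrA (mulrC e) mulfVK // mulrN mulrC.
case=> k /eqP[-> ->]; rewrite /fst /snd; split; first by apply/eqP; ring.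
have -> : g * (k * - f) + h * (k * e) = k * (e * h - f * g) by ring.
by rewrite D mulr0.
Qed.

Lemma card_line (v : vec) : v != 0 ->
    #|[pred x : vec | (x != 0) && [exists k, x == scal k v]]| = 6%N.
Proof.
move=> v0.
have inj : injective (fun k => scal k v).
  case: v v0 => y z v0 k l e; apply/eqP; rewrite -subr_eq0; apply: contraNT v0 => kl.
  have E1 : (k - l) * y == 0 by rewrite mulrBl subr_eq0; apply/eqP; apply: (congr1 fst e).
  have E2 : (k - l) * z == 0 by rewrite mulrBl subr_eq0; apply/eqP; apply: (congr1 snd e).
  move: E1 E2; rewrite !mulf_eq0 (negPf kl) => /eqP y0 /eqP z0.
  by rewrite y0 z0.
have c6 : #|[pred k : 'F_7 | k != 0]| = 6%N by rewrite cardC1 card_ord.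
rewrite -[RHS]c6 -(card_image inj); apply: eq_card => x; rewrite !inE.
apply/andP/imageP => [[x0 /existsP[k /eqP e]]|[k]].
  exists k => //; rewrite inE; apply: contraNneq x0 => k0.
  by rewrite e k0 scal_eq0 eqxx.
rewrite inE => k0 ->; split; first by rewrite scal_eq0 negb_or k0.
by apply/existsP; exists k.
Qed.

Lemma sum_b2i (P : pred vec) : \sum_(x : vec | x != 0) b2i (P x) =
    #|[pred x : vec | (x != 0) && P x]|%:Z.
Proof.
rewrite -sum1_card (big_morph Posz PoszD (erefl _)) /= big_mkcondr /=.
by apply: eq_bigr => x _; case: (P x).
Qed.

Lemma kernel_count (e f g h : 'F_7) : (e, f, g, h) != 0 ->
  \sum_(x : vec | x != 0) b2i ((e * x.1 + f * x.2 == 0) && (g * x.1 + h * x.2 == 0))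
  = 6 * b2i (e * h - f * g == 0).
Proof.
move=> n0; rewrite sum_b2i; case: eqP => [D|/eqP D]; last first.
  rewrite mulr0 eq_card0 // => -[x y]; rewrite !inE /fst /snd;
      apply/negP => /and3P[xy /eqP E1 /eqP E2].
  case/negP: xy; rewrite -pair_eqE /pair_eq /=; apply/andP; split.
    have : (e * h - f * g) * x == 0.
      have -> : (e * h - f * g) * x = h * (e * x + f * y) - f * (g * x + h * y) by ring.
      by rewrite E1 E2 !mulr0 subr0.
    by rewrite mulf_eq0 (negPf D).
  have : (e * h - f * g) * y == 0.
    have -> : (e * h - f * g) * y = e * (g * x + h * y) - g * (e * x + f * y) by ring.
    by rewrite E1 E2 !mulr0 subr0.
  by rewrite mulf_eq0 (negPf D).
rewrite (_ : 6 * b2i true = Posz 6) //.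
case: (eqVneq (e, f) 0) => [ef|ef].
  have [e0 f0] : e = 0 /\ f = 0 by split; [apply: (congr1 fst ef)|apply: (congr1 snd ef)].
  have gh : (g, h) != 0 by apply: contraNneq n0 => gh;
      rewrite e0 f0 (congr1 fst gh : g = 0) (congr1 snd gh : h = 0).
  have hg : (- h, g) != 0.
    by move: gh; rewrite -!pair_eqE /pair_eq /fst /snd oppr_eq0 andbC.
  congr Posz; rewrite -[RHS](card_line _ hg); apply: eq_card => x; rewrite !inE; congr (_ && _).
  rewrite andbC (kernel_line _ _ e f) //.
  by rewrite e0 f0 !mulr0 subrr.
have fe : (- f, e) != 0.
  by move: ef; rewrite -!pair_eqE /pair_eq /fst /snd oppr_eq0 andbC.
by congr Posz; rewrite -[RHS](card_line _ fe); apply: eq_card => x; rewrite !inE;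
    congr (_ && _); rewrite kernel_line.
Qed.

Definition chi (al : 'F_7) (M : mat) : int := \sum_(x :
    vec | x != 0) delta (scal al x) (vact M x).
Definition tr (M : mat) : int := let: (a, b, c, d) := M in a + d.

(** The hypothesis excludes that M is the scalar l, so an eigenspace for l is a line, with 6 nonzero
    vectors. *)
Lemma eigen_count M (l : 'F_7) : l ^+ 2 != (det M)%:~R ->
  \sum_(x : vec | x != 0) b2i (vact M x == scal l x) =
  6 * b2i (l ^+ 2 - (tr M)%:~R * l + (det M)%:~R == 0).
Proof.
case: M => [[[a b] c] d]; rewrite /det /tr => l2.
have := kernel_count (a%:~R - l) b%:~R c%:~R (d%:~R - l).
rewrite (_ : (a%:~R - l) * (d%:~R - l) - b%:~R * c%:~R =
   l ^+ 2 - (a + d)%:~R * l + (a * d - b * c)%:~R); last first.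
  by rewrite rmorphB /= !rmorphD !rmorphM /=; ring.
move=> <-; last first.
  apply: contra l2; rewrite !xpair_eqE !subr_eq0.
  case/andP=> /andP[/andP[/eqP ea /eqP eb] /eqP ec] /eqP ed.
  by rewrite rmorphB !rmorphM /= ea eb ec ed mulr0 subr0 expr2.
apply: eq_bigr => -[x y] _; rewrite /vact /scal /fst /snd -pair_eqE /pair_eq /fst /snd.
rewrite -[in LHS]subr_eq0 -[X in _ && X]subr_eq0; congr b2i; congr (_ && _); congr (_ == _); ring.
Qed.

Lemma chiE (al : 'F_7) M : al != 0 -> al ^+ 2 != (det M)%:~R ->
  chi al M = 6 * (b2i ((tr M)%:~R == al + (det M)%:~R / al) + b2i ((tr M)%:~R == - (al +
      (det M)%:~R / al))).
Proof.
move=> al0 al2; rewrite /chi /delta big_split /=.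
have eN x : - scal al x = scal (- al) x by rewrite /scal; congr (_, _); rewrite mulNr.
under [X in _ + X]eq_bigr do rewrite eN.
rewrite !eigen_count ?sqrrN // mulrDr; congr (_ * b2i _ + _ * b2i _).
  rewrite -[RHS](inj_eq (mulfI al0)) -[RHS]subr_eq0 -[RHS]oppr_eq0; congr (_ == 0).
  by field.
rewrite -[RHS](inj_eq (mulfI al0)) -[RHS]subr_eq0; congr (_ == 0).
by field.
Qed.

(** * Reduction of binary quadratic forms *)

Lemma sl2_refl f : sl2_equiv f f.
Proof.
exists 1, 0, 0, 1; split; first by lia.
by case: f => [[a b] c]; rewrite /act /qa /qb /qc /=; congr (_, _, _); ring.
Qed.
Lemma sl2_sym f g : sl2_equiv f g -> sl2_equiv g f.
Proof.
case=> a [b [c [d [e ->]]]]; exists d, (- b), (- c), a; split; first by lia.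
case: f => [[x y] z]; rewrite /act /qa /qb /qc /=.
have E : (a * d - b * c) ^+ 2 = 1 by rewrite e.
by congr (_, _, _); rewrite -[LHS]mulr1 -[in LHS]E; ring.
Qed.
Lemma sl2_trans f g h : sl2_equiv f g -> sl2_equiv g h -> sl2_equiv f h.
Proof.
case=> a [b [c [d [e ->]]]] [a' [b' [c' [d' [e' ->]]]]].
exists (a * a' + b * c'), (a * b' + b * d'), (c * a' + d * c'), (c * b' + d * d'); split.
  by rewrite -[RHS](mulr1 1) -{1}e -e'; ring.
by case: f => [[x y] z]; rewrite /act /qa /qb /qc /=; congr (_, _, _); ring.
Qed.

Lemma disc_equiv f g : sl2_equiv f g -> disc g = disc f.
Proof.
case=> a [b [c [d [e ->]]]]; case: f => [[x y] z]; rewrite /disc /act /qa /qb /qc /=.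
transitivity ((a * d - b * c) ^+ 2 * (y ^+ 2 - 4 * x * z)); first by ring.
by rewrite e expr1n mul1r.
Qed.

Lemma value_pos (A B C x y : int) : 0 < A -> B ^+ 2 - 4 * A * C < 0 -> (x, y) != (0, 0) ->
  0 < A * x ^+ 2 + B * x * y + C * y ^+ 2.
Proof.
move=> A0 D xy; rewrite -(pmulr_rgt0 _ A0) -(pmulr_rgt0 (x := 4)) //.
have -> : 4 * (A * (A * x ^+ 2 + B * x * y + C * y ^+ 2)) =
  (2 * A * x + B * y) ^+ 2 + (4 * A * C - B ^+ 2) * y ^+ 2 by ring.
case: (eqVneq y 0) => [y0|y0].
  have x0 : x != 0 by apply: contraNneq xy => ->; rewrite y0.
  rewrite y0 (_ : _ + _ = (2 * A * x) ^+ 2); last by ring.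
  by rewrite exprn_even_gt0 //= !mulf_neq0 // gt_eqF.
by apply: ltr_wpDl; rewrite ?sqr_ge0 // mulr_gt0 ?exprn_even_gt0 //; lia.
Qed.

Lemma posdef_equiv f g : sl2_equiv f g -> posdef f -> posdef g.
Proof.
move=> fg /andP[df af]; rewrite /posdef (disc_equiv _ _ fg) df /=.
case: fg => a [b [c [d [e ->]]]].
case: f df af => [[A B] C]; rewrite /disc /act /qa /qb /qc /= => df af.
by apply: value_pos => //; apply/eqP => -[a0 c0]; rewrite a0 c0 in e; lia.
Qed.

(* Boundary forms with [b = a] are represented by [b = -a], so that
   [k(x^2 + xy + y^2)] corresponds to the reduced form [(k, -k, k)]. *)
Definition reduced (f : bqf) : bool := let: (A, B, C) := f in
  [&& 0 < A, - A <= B, B < A, A <= C & (A == C) ==> (B <= 0)].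

Lemma reduced_posdef f : reduced f -> posdef f.
Proof.
case: f => [[A B] C] /and5P[A0 AB BA AC _]; rewrite /posdef /disc /qa /qb /qc /= A0 andbT.
by nia.
Qed.

(** Descent on A: a translation brings B into [-A, A), and if then C < A, exchanging A and C lowers
    the leading coefficient. *)
Lemma reduce f : posdef f -> exists2 g, reduced g & sl2_equiv f g.
Proof.
have [n] := ubnP (`|qa f|)%N; elim: n f => // n IH f.
case: f => [[A B] C]; rewrite /posdef /disc /qa /qb /qc /= => An /andP[D A0].
pose k := ((B + A) %/ (2 * A))%Z.
have [r1 r2] : - A <= B - 2 * A * k /\ B - 2 * A * k < A.
  have := divz_eq (B + A) (2 * A); have := ltz_pmod (B + A) (d := 2 * A);
      have := modz_ge0 (B + A) (d := 2 * A).
  by rewrite -/k; lia.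
pose g : bqf := (A, B - 2 * A * k, A * k ^+ 2 - B * k + C).
have fg : sl2_equiv (A, B, C) g.
  by exists 1, (- k), 0, 1; split; [lia | rewrite /act /g /qa /qb /qc /=; congr (_, _, _); ring].
have gpos : posdef g by apply: posdef_equiv fg _; rewrite /posdef /disc /qa /qb /qc /= D A0.
have C0 : 0 < A * k ^+ 2 - B * k + C.
  rewrite (_ : _ + C = A * (- k) ^+ 2 + B * (- k) * 1 + C * 1 ^+ 2); last by ring.
  by apply: value_pos; rewrite // xpair_eqE andbF.
have swap (a b c : int) : sl2_equiv (a, b, c) (c, - b, a).
  exists 0, (-1), 1, 0; split; first by lia.
  by rewrite /act /qa /qb /qc /=; congr (_, _, _); ring.
move: fg gpos r1 r2 C0; rewrite /g; move: (B - _) (_ - B * k + C) => b c fg gpos r1 r2 c0.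
case: (ltrgtP A c) => Ac.
- exists (A, b, c) => //; rewrite /reduced A0 r1 r2 (ltW Ac) /=; apply/implyP=> /eqP; lia.
- have [||h hr gh] := IH (c, - b, A); first by rewrite /qa /=; lia.
    by apply: posdef_equiv gpos; apply: swap.
  by exists h => //; apply: sl2_trans fg (sl2_trans _ _ _ (swap _ _ _) gh).
- subst c; case: (lerP b 0) => b0.
    by exists (A, b, A) => //; rewrite /reduced A0 r1 r2 lexx eqxx b0.
  exists (A, - b, A); last exact: sl2_trans fg (swap _ _ _).
  by rewrite /reduced A0 lexx eqxx /=; lia.
Qed.

Lemma reduced_value (A B C x y : int) : reduced (A, B, C) -> y != 0 ->
  C <= A * x ^+ 2 + B * x * y + C * y ^+ 2.
Proof.
move=> /and5P[A0 AB BA AC _] y0.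
have Bn : - A <= B <= A by lia.
have B' : `|B * x * y| <= A * (`|x| * `|y|).
  by rewrite -mulrA !normrM ler_wpM2r ?mulr_ge0 // ler_norml Bn.
have x2 : x ^+ 2 = `|x| ^+ 2 by rewrite real_normK ?num_real.
have y2 : y ^+ 2 = `|y| ^+ 2 by rewrite real_normK ?num_real.
have y1 : 1 <= `|y| by rewrite -gtz0_ge1 normr_gt0.
have x0 : 0 <= `|x| by [].
have {B'} : - (A * (`|x| * `|y|)) <= B * x * y by have := lerNnormlW B'; lia.
rewrite x2 y2; move: (B * x * y) `|x|%R `|y|%R y1 x0 => z u v v1 u0 zb.
(* If |y| <= |x|, the term A x^2 absorbs the cross term. Otherwise y^2 >= |x y| + 1, and C y^2
   absorbs it with C to spare. *)
case: (lerP v u) => uv.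
  have : A * (u * v) <= A * u ^+ 2 by rewrite ler_wpM2l ?(ltW A0) // expr2 ler_wpM2l.
  have : C * 1 <= C * v ^+ 2 by rewrite ler_wpM2l; nia.
  by lia.
have : A * (u * v) <= C * (u * v) by rewrite ler_wpM2r ?mulr_ge0 //; lia.
have : 0 <= A * u ^+ 2 by rewrite mulr_ge0 ?sqr_ge0 // ltW.
have : C * (u * v + 1) <= C * v ^+ 2 by rewrite ler_wpM2l; nia.
by lia.
Qed.

Lemma reduced_le f g : reduced f -> sl2_equiv f g -> qa f <= qa g.
Proof.
move=> rf [a [b [c [d [e ->]]]]]; case: f rf => [[A B] C] rf; rewrite /act /qa /qb /qc /=.
have /and5P[A0 _ _ AC _] := rf.
case: (eqVneq c 0) => [c0|c0]; last exact: le_trans AC (reduced_value _ _ _ _ _ rf c0).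
have a0 : a != 0 by apply/eqP => a0; rewrite a0 c0 in e; lia.
have a1 : 1 <= a ^+ 2 by rewrite -gtz0_ge1 exprn_even_gt0.
by rewrite c0 (_ : _ + _ = A * a ^+ 2) ?ler_peMr // ?ltW //; ring.
Qed.

Lemma shift0 (A B b : int) : 0 < A -> - A <= B < A -> - A <= B + 2 * (A * b) < A -> b = 0.
Proof.
move=> A0 B1 B2; case: (ltrgtP b 0) => // b0.
  have : A * 1 <= A * (- b) by rewrite ler_wpM2l; lia.
  by lia.
have : A * 1 <= A * b by rewrite ler_wpM2l; lia.
by lia.
Qed.

(** Both leading coefficients are the minimum of the class. Either the equivalence is a translation
    up to sign, hence trivial by [shift0], or both forms have A = C, where the condition B <= 0
    fixes the sign of B. *)
Lemma reduced_unique f g : reduced f -> reduced g -> sl2_equiv f g -> f = g.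
Proof.
move=> rf rg fg; have gf := sl2_sym _ _ fg.
have Aeq : qa f = qa g by apply/eqP; rewrite eq_le !reduced_le.
have Deq := disc_equiv _ _ fg.
case: fg => a [b [c [d [e eg]]]].
have C_le (x y : int) (h k : bqf) : reduced h -> qa k = qa h ->
    qa k = qa h * x ^+ 2 + qb h * x * y + qc h * y ^+ 2 -> y != 0 -> qc h = qa h.
  case: h => [[A B] C] rh; rewrite /qa /qb /qc /= => -> E y0.
  have := reduced_value _ _ _ x _ rh y0; rewrite -E.
  by have /and5P[_ _ _ AC _] := rh; lia.
case: (eqVneq c 0) => [c0|c0].
  have ad : (a = 1 /\ d = 1) \/ (a = -1 /\ d = -1).
    rewrite c0 mulr0 subr0 in e.
    have /eqP : (`|a| * `|d|)%N = 1%N by rewrite -abszM e.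
    rewrite muln_eq1 => /andP[/eqP a1 /eqP d1].
    have [a2|a2] : a = 1 \/ a = -1 by lia.
      by left; rewrite a2 in e *; lia.
    by right; rewrite a2 in e *; lia.
  case: f rf Aeq Deq eg {gf} => [[A B] C] rf Aeq Deq eg; rewrite eg in rg *.
  move: rg rf; rewrite /reduced /act /qa /qb /qc /= c0.
  case: ad => -[-> ->] /and5P[_ r1 r2 _ _] /and5P[A0 r3 r4 _ _].
    have b0 : b = 0 by apply: (shift0 A B); lia.
    by rewrite b0; congr (_, _, _); ring.
  have b0 : b = 0 by apply/eqP; rewrite -oppr_eq0; apply/eqP/(shift0 A B); lia.
  by rewrite b0; congr (_, _, _); ring.
have Cf : qc f = qa f.
  by apply: (C_le a c f g) => //; rewrite eg; case: (f) => [[A B] C].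
have Cg : qc g = qa g.
  apply: (C_le d (- c) g f) => //; last by rewrite oppr_eq0.
  have E : (a * d - b * c) ^+ 2 = 1 by rewrite e.
  rewrite eg; case: (f) => [[A B] C]; rewrite /act /qa /qb /qc /=.
  by rewrite -[LHS]mulr1 -[in LHS]E; ring.
case: f g rf rg Aeq Deq Cf Cg {eg gf} => [[A B] C] [[A' B'] C'].
rewrite /disc /qa /qb /qc /= => /and5P[A0 _ _ _ r1] /and5P[_ _ _ _ r2] Aeq Deq Cf Cg; subst.
by congr (_, _, _); nia.
Qed.

Definition forms (n : nat) (N : nat) : seq bqf :=
  [seq f <- pairs (pairs (rng n) (rng n)) (rng n) | disc f == - N%:Z].
Lemma forms_uniq n N : uniq (forms n N).
Proof. by rewrite filter_uniq // !pairs_uniq ?rng_uniq. Qed.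
Definition fbnd (n : nat) (f : bqf) := [&& `|qa f| <= n, `|qb f| <= n & `|qc f| <= n]%N.
Lemma mem_forms n N f : (f \in forms n N) = (disc f == - N%:Z) && fbnd n f.
Proof. by case: f => [[a b] c]; rewrite mem_filter !mem_pairs !mem_rng -!andbA. Qed.

(* Twelve times the weight of the class of a reduced form. *)
Definition wt (f : bqf) : int := let: (A, B, C) := f in
  if (A == C) && (B == 0) then 6 else if (A == C) && (B == - A) then 4 else 12.

Lemma reduced_bnd N f : reduced f -> disc f = - N%:Z -> fbnd N f.
Proof.
case: f => [[A B] C] /and5P[A0 r1 r2 AC _]; rewrite /disc /fbnd /qa /qb /qc /= => D.
have B2 : B ^+ 2 <= A ^+ 2 by nia.
have CN : C <= N by nia.
by lia.
Qed.

Lemma cls_weight_reduced f g : sl2_equiv f g -> reduced g -> cls_weight f = (wt g)%:~R / 12.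
Proof.
move=> fg rg; rewrite /cls_weight.
have uniq k h : reduced h -> sl2_equiv f k -> sl2_equiv k h -> g = h.
  by move=> rh fk kh; apply: reduced_unique => //;
      apply: sl2_trans (sl2_sym _ _ fg) (sl2_trans _ _ _ fk kh).
have kkk k : sl2_equiv (k, k, k) (k, - k, k).
  exists 0, (-1), 1, 0; split; first by lia.
  by rewrite /act /qa /qb /qc /=; congr (_, _, _); ring.
case: excluded_middle_informative => [[k [k0 fk]]|n2].
  have -> : g = (k, 0, k) by apply: uniq fk (sl2_refl _); rewrite /reduced; lia.
  by rewrite /wt !eqxx.
case: excluded_middle_informative => [[k [k0 fk]]|n3].
  have -> : g = (k, - k, k) by apply: uniq fk (kkk k); rewrite /reduced; lia.
  by rewrite /wt !eqxx oppr_eq0 gt_eqF.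
case: g fg rg {uniq} => [[A B] C] fg /and5P[A0 _ _ _ _]; rewrite /wt.
case: eqP => [AC|_ //]; subst C => /=.
case: eqP => [B0|_]; first by case: n2; exists A; rewrite B0 in fg.
case: eqP => [BA|_ //]; case: n3; exists A; split=> //; rewrite BA in fg.
by apply: sl2_trans fg (sl2_sym _ _ (kkk A)).
Qed.

Lemma class_number_reduced N : (N != 0)%N -> ~~ ((N %% 4 == 1)%N || (N %% 4 == 2)%N) ->
  H N = (\sum_(f <- forms N N | reduced f) wt f)%:~R / 12.
Proof.
move=> N0 N4; pose s := [seq f <- forms N N | reduced f].
have mem_s f : (f \in s) = reduced f && (disc f == - N%:Z).
  rewrite mem_filter mem_forms; case: (boolP (reduced f)) => //= rf.
  by case: eqP => //= D; rewrite (reduced_bnd _ _ rf D).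
have us : uniq s by rewrite filter_uniq ?forms_uniq.
have Hs : class_reps N s.
  split=> [f|]; first by rewrite mem_s => /andP[/reduced_posdef ? /eqP].
  split=> [f pf df|f g]; last by rewrite !mem_s => /andP[? _] /andP[? _]; apply: reduced_unique.
  have [g rg fg] := reduce f pf; exists g => //.
  by rewrite mem_s rg (disc_equiv _ _ fg) df eqxx.
have : HurwitzSpec N (H N).
  apply: (epsilon_spec (inhabits 0) (HurwitzSpec N)); exists (\sum_(f <- s) cls_weight f).
  by rewrite /HurwitzSpec (negPf N0) (negPf N4); exists s.
rewrite /HurwitzSpec (negPf N0) (negPf N4) => -[t [ut [[t1 [t2 t3]] ->]]].
(* [H] may rest on any list of representatives; [rho] matches that list with the reduced forms. *)
pose rho f := epsilon (inhabits f) (fun g => reduced g /\ sl2_equiv f g).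
have rhoP f : f \in t -> reduced (rho f) /\ sl2_equiv f (rho f).
  move=> /t1[pf _]; apply: (epsilon_spec (inhabits f) (fun g => reduced g /\ sl2_equiv f g)).
  by have [g] := reduce f pf; exists g.
rewrite (eq_big_seq (fun f => (wt (rho f))%:~R / 12)); last first.
  by move=> f /rhoP[rf fr]; apply: cls_weight_reduced.
rewrite -mulr_suml -(big_morph _ (rmorphD intr) (rmorph0 intr)); congr (_%:~R / _).
rewrite -(big_map rho predT wt) -[RHS]big_filter; apply: perm_big; apply: uniq_perm => //.
  rewrite map_inj_in_uniq // => f g ft gt e; apply: t3 => //.
  by have [_ fr] := rhoP f ft; have [_ gr] := rhoP g gt; apply: sl2_trans fr _; rewrite e;
      apply: sl2_sym.
move=> g; rewrite -/s mem_s; apply/mapP/andP => [[f ft ->]|[rg /eqP dg]].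
  by have [rf fr] := rhoP f ft; have [_ df] := t1 f ft; rewrite rf (disc_equiv _ _ fr) df eqxx.
have [f ft gf] := t2 g (reduced_posdef _ rg) dg; exists f => //.
by have [rf fr] := rhoP f ft; apply: reduced_unique => //; apply: sl2_trans gf fr.
Qed.

(** * Class numbers as sums over obtuse superbases *)

(* The analogue of [ellw] for forms; each class of weight 1 is counted six times. *)
Definition obtuse (f : bqf) : int := let: (A, B, C) := f in
  b2i [&& 0 < A, 0 < C, 0 < A + B + C, B <= 0, 0 <= B + 2 * C & 0 <= B + 2 * A]
  + b2i [&& 0 < A, 0 < C, 0 < A + B + C, B < 0, 0 < B + 2 * C & 0 < B + 2 * A].

(* Selects, in the orbit of f under fU, the forms that are minimal at (1, 0), up to ties. *)
Definition third (f : bqf) : int := let: (A, B, C) := f in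
  obtuse f * (6 * b2i ((A < C) && (A < A + B + C)) + 3 * b2i ((A == C) && (A < A + B + C))
   + 3 * b2i ((A < C) && (A == A + B + C)) + 2 * b2i ((A == C) && (A == A + B + C))).

(** [fU] rotates the values A, C, A + B + C at the three vectors of a superbase; [fU'] is its
    inverse. *)
Definition fU (f : bqf) : bqf := let: (A, B, C) := f in (C, - B - 2 * C, A + B + C).
Definition fU' (f : bqf) : bqf := let: (A, B, C) := f in (A + B + C, - B - 2 * A, A).
Definition fS (f : bqf) : bqf := let: (A, B, C) := f in (C, - B, A).
Definition fT (f : bqf) : bqf := let: (A, B, C) := f in (A, B - 2 * A, C - B + A).
Definition fT' (f : bqf) : bqf := let: (A, B, C) := f in (A, B + 2 * A, C + B + A).

Lemma fUK : cancel fU fU'.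
Proof. by case=> [[A B] C]; rewrite /fU /fU'; congr (_, _, _); ring. Qed.
Lemma fUK' : cancel fU' fU.
Proof. by case=> [[A B] C]; rewrite /fU /fU'; congr (_, _, _); ring. Qed.
Lemma fSK : involutive fS.
Proof. by case=> [[A B] C]; rewrite /fS opprK. Qed.
Lemma fTK : cancel fT fT'.
Proof. by case=> [[A B] C]; rewrite /fT /fT'; congr (_, _, _); ring. Qed.
Lemma fTK' : cancel fT' fT.
Proof. by case=> [[A B] C]; rewrite /fT /fT'; congr (_, _, _); ring. Qed.

(** An obtuse form that is minimal at (1, 0) has -2A <= B <= 0. The part with B < -A is carried by
    [fT'] to 0 <= B < A. *)
Definition third_l (f : bqf) : int := let: (A, B, C) := f in if - A <= B then third f else 0.
Definition third_r (f : bqf) : int := let: (A, B, C) := f in if B < - A then third f else 0.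
(* Compares the two reduced-looking forms (A, B, A) and (A, - B, A). *)
Definition tie (f : bqf) : int := let: (A, B, C) := f in 6 * b2i [&& A == C, - A < B & B < 0].

Lemma obtuse_third f : 6 * obtuse f = third f + third (fU f) + third (fU' f).
Proof.
case: f => [[A B] C]; rewrite /third /fU /fU'.
have -> : C + (- B - 2 * C) + (A + B + C) = A by lia.
have -> : A + B + C + (- B - 2 * A) + A = C by lia.
have [w Hw] : exists w, w = A + B + C by eexists.
have -> : obtuse (C, - B - 2 * C, A + B + C) = obtuse (A, B, C) by rewrite /obtuse /b2i; lia.
have -> : obtuse (A + B + C, - B - 2 * A, A) = obtuse (A, B, C) by rewrite /obtuse /b2i; lia.
rewrite -Hw; move: (obtuse _) => o.
case: (ltrgtP A C) => AC; case: (ltrgtP A w) => Aw; case: (ltrgtP C w) => Cw; try (exfalso; lia).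
all: by rewrite /b2i /=; lia.
Qed.

Lemma third_split f : third f = third_l f + third_r f.
Proof.
case: f => [[A B] C]; rewrite /third_l /third_r.
by case: lerP; rewrite ?addr0 ?add0r.
Qed.

Ltac ival t := first
  [ have -> : t = 0 by rewrite /obtuse /b2i; lia
  | have -> : t = 1 by rewrite /obtuse /b2i; lia
  | have -> : t = 2 by rewrite /obtuse /b2i; lia].
Ltac bval t := first [have -> : t = true by lia | have -> : t = false by lia].

(** For A = C the weight is shared between (A, B, A) and (A, -B, A), while only the form with B <= 0
    is reduced; the two [tie] terms transfer it and cancel in the sum over all forms. *)
Lemma third_reduced f : third_l f + third_r (fT f) =
  (if reduced f then wt f else 0) + tie (fS f) - tie f.
Proof.
case: f => [[A B] C]; rewrite /third_l /third_r /third /fT /fS /tie /reduced /wt.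
have -> : A + (B - 2 * A) + (C - B + A) = C by lia.
have [A0|A0] : A <= 0 \/ 0 < A by lia.
  ival (obtuse (A, B, C)); ival (obtuse (A, B - 2 * A, C - B + A)); rewrite !mul0r !if_same.
  bval [&& 0 < A, - A <= B, B < A, A <= C & (A == C) ==> (B <= 0)].
  bval [&& C == A, - C < - B & - B < 0]; bval [&& A == C, - A < B & B < 0].
  by [].
have [AC|[AC|AC]] : A < C \/ A = C \/ C < A by lia.
all: have [BA|[BA|[BA|[BA|[BA|BA]]]]] : B < - A \/ B = - A \/ - A < B < 0 \/ B =
    0 \/ 0 < B < A \/ A <= B by lia.
all: bval [&& 0 < A, - A <= B, B < A, A <= C & (A == C) ==> (B <= 0)].
all: bval [&& C == A, - C < - B & - B < 0]; bval [&& A == C, - A < B & B < 0].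
all: bval (- A <= B); bval (B - 2 * A < - A).
all: rewrite //.
all: try bval ((A == C) && (B == 0)); try bval ((A == C) && (B == - A)).
all: try ival (obtuse (A, B, C)); try ival (obtuse (A, B - 2 * A, C - B + A)).
all: rewrite /b2i; lia.
Qed.

Lemma obtuse_bnd N f : disc f = - N%:Z -> obtuse f != 0 -> fbnd N.*2 f.
Proof.
case: f => [[A B] C]; rewrite /disc /fbnd /qa /qb /qc /= => D.
move=> h; have : [&& 0 < A, 0 < C, 0 < A + B + C, B <= 0, 0 <= B + 2 * C & 0 <= B + 2 * A].
  by move: h; rewrite /b2i; lia.
case/and5P=> A0 C0 w0 B0 /andP[BC BA].
have AN : A <= N.
  have [AC|AC] : A <= C \/ C <= A by lia.
    by nia.
  by nia.
have CN : C <= N by nia.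
by lia.
Qed.

Lemma fbnd_le m n f : (m <= n)%N -> fbnd m f -> fbnd n f.
Proof. by rewrite /fbnd; lia. Qed.

Lemma sum_forms_reindex n N m (g : bqf -> int) phi psi : (6 * m <= n)%N ->
    cancel phi psi -> cancel psi phi -> (forall f, disc (psi f) = disc f) ->
    (forall f, fbnd m f -> fbnd (6 * m) (psi f)) ->
    (forall f, disc f = - N%:Z -> g f != 0 -> fbnd m f) ->
  \sum_(f <- forms n N) g (phi f) = \sum_(f <- forms n N) g f.
Proof.
move=> mn phiK psiK dpsi bpsi gb.
apply: (big_reindex_supp _ _ (fun f => disc f == - N%:Z) phi psi) => //.
- exact: forms_uniq.
- by move=> f; rewrite mem_forms => /andP[].
- by move=> f; rewrite dpsi.
- move=> f /eqP df gf; have fb := gb f df gf; rewrite !mem_forms dpsi df eqxx /=.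
  by rewrite (fbnd_le _ _ _ _ fb) ?(fbnd_le _ _ _ mn (bpsi _ fb)) //; lia.
Qed.

Lemma sum_obtuse n N : (N != 0)%N -> ~~ ((N %% 4 == 1)%N || (N %% 4 == 2)%N) -> (12 * N <= n)%N ->
  (\sum_(f <- forms n N) obtuse f)%:~R = 6 * H N.
Proof.
move=> N0 N4 Nn; rewrite (class_number_reduced _ N0 N4).
suff : 2 * \sum_(f <- forms n N) obtuse f = \sum_(f <- forms N N | reduced f) wt f.
  by move=> <-; rewrite rmorphM /=; field.
have Nn' : (6 * N.*2 <= n)%N by lia.
have tb f : disc f = - N%:Z -> third f != 0 -> fbnd N.*2 f.
  by move=> df h; apply: obtuse_bnd => //; apply: contraNneq h;
      case: f {df} => [[A B] C] /= ->; rewrite mul0r.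
have trb f : disc f = - N%:Z -> third_r f != 0 -> fbnd N.*2 f.
  by move=> df h; apply: tb => //; move: h; case: f {df} => [[A B] C] /=; case: ifP => // _ /eqP.
have tieb f : disc f = - N%:Z -> tie f != 0 -> fbnd N.*2 f.
  case: f => [[A B] C]; rewrite /disc /fbnd /qa /qb /qc /= => D h.
  have /and3P[/eqP AC AB B0] : [&& A == C, - A < B & B < 0] by move: h; rewrite /b2i; lia.
  by subst C; nia.
have ld f phi : (forall g, phi g = fU g \/ phi g = fU' g \/ phi g = fS g \/ phi g = fT' g) ->
    disc (phi f) = disc f /\ (fbnd N.*2 f -> fbnd (6 * N.*2) (phi f)).
  move=> /(_ f); case: f => [[A B] C] e; rewrite /fbnd /disc.
  by case: e => [|[|[]]] ->; rewrite /qa /qb /qc /=; split; [ring|lia|ring|lia|ring|lia|ring|lia].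
have eU : \sum_(f <- forms n N) third (fU f) = \sum_(f <- forms n N) third f.
  by apply: (sum_forms_reindex n N N.*2 third fU fU' Nn' fUK fUK' _ _ tb) => f;
    have [] := ld f fU' _; auto.
have eU' : \sum_(f <- forms n N) third (fU' f) = \sum_(f <- forms n N) third f.
  by apply: (sum_forms_reindex n N N.*2 third fU' fU Nn' fUK' fUK _ _ tb) => f;
    have [] := ld f fU _; auto.
have eT : \sum_(f <- forms n N) third_r (fT f) = \sum_(f <- forms n N) third_r f.
  by apply: (sum_forms_reindex n N N.*2 third_r fT fT' Nn' fTK fTK' _ _ trb) => f;
    have [] := ld f fT' _; auto.
have eS : \sum_(f <- forms n N) tie (fS f) = \sum_(f <- forms n N) tie f.
  by apply: (sum_forms_reindex n N N.*2 tie fS fS Nn' fSK fSK _ _ tieb) => f;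
    have [] := ld f fS _; auto.
have h1 : 6 * \sum_(f <- forms n N) obtuse f = 3 * \sum_(f <- forms n N) third f.
  rewrite mulr_sumr (eq_bigr (fun f => third f + third (fU f) + third (fU' f))); last first.
    by move=> f _; apply: obtuse_third.
  by rewrite !big_split /= eU eU'; ring.
have h2 : \sum_(f <- forms n N) third f = \sum_(f <- forms n N) (if reduced f then wt f else 0).
  rewrite (eq_bigr (fun f => third_l f + third_r f)); last by move=> f _; apply: third_split.
  rewrite big_split /= -eT -big_split /=.
  rewrite (eq_bigr (fun f => (if reduced f then wt f else 0) + tie (fS f) - tie f)); last first.
    by move=> f _; apply: third_reduced.
  by rewrite sumrB big_split /= eS addrK.
have h3 : \sum_(f <- forms n N) (if reduced f then wt f else 0) =
    \sum_(f <- forms N N | reduced f) wt f.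
  rewrite [RHS]big_mkcond /=; apply: big_supp_sub; rewrite ?forms_uniq //.
    by move=> f; rewrite !mem_forms => /andP[-> fb]; rewrite (fbnd_le _ _ _ _ fb) //; lia.
  move=> f; rewrite !mem_forms => /andP[/eqP df _]; case: ifP => [rf _|_ /eqP//].
  by rewrite df eqxx (reduced_bnd _ _ rf df).
by lia.
Qed.

(** * From matrices to class numbers *)

(** The form of the fixed point equation c z^2 + (d - a) z - b = 0. *)
Definition form (M : mat) : bqf := let: (a, b, c, d) := M in (c, d - a, - b).
Definition oppm (M : mat) : mat := let: (a, b, c, d) := M in (- a, - b, - c, - d).

Lemma ellwE M : ellw M = obtuse (form M) + obtuse (form (oppm M)).
Proof.
case: M => [[[a b] c] d]; rewrite /ellw /obtuse /form /oppm /= [RHS]addrA.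
by congr (b2i _ + b2i _ + b2i _ + b2i _); lia.
Qed.

Lemma disc_form M : disc (form M) = tr M ^+ 2 - 4 * det M.
Proof. by case: M => [[[a b] c] d]; rewrite /disc /form /tr /det /qa /qb /qc /=; ring. Qed.

Lemma obtuse_disc f : obtuse f != 0 -> disc f < 0.
Proof.
case: f => [[A B] C] h; have : [&& 0 < A, 0 < C, 0 < A + B + C, B <= 0, 0 <= B +
    2 * C & 0 <= B + 2 * A].
  by move: h; rewrite /obtuse /b2i; lia.
by case/and5P=> A0 C0 w0 B0 /andP[BC BA]; rewrite /disc /qa /qb /qc /=; nia.
Qed.

Definition of_form (r : int) (f : bqf) : mat :=
  let: (A, B, C) := f in (((r - B) %/ 2)%Z, - C, A, ((r + B) %/ 2)%Z).

Lemma of_formK r M : tr M = r -> of_form r (form M) = M.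
Proof. by case: M => [[[a b] c] d] /= <-; congr (_, _, _, _); lia. Qed.

Lemma parity_disc (r B k : int) : B ^+ 2 - r ^+ 2 = 4 * k -> exists q, B = r + 2 * q.
Proof.
move=> e; exists ((B - r) %/ 2)%Z; have : ((B - r) %% 2 = 0)%Z; last by lia.
have B2 := divz_eq B 2; have r2 := divz_eq r 2; set q := (B %/ 2)%Z in B2;
    set t := (r %/ 2)%Z in r2.
have hB : (B %% 2 = 0 \/ B %% 2 = 1)%Z by lia.
have hr : (r %% 2 = 0 \/ r %% 2 = 1)%Z by lia.
by case: hB => hB; case: hr => hr; rewrite hB hr in B2 r2 *; rewrite B2 r2 in e *; nia.
Qed.

Lemma form_ofK r f (k : int) : disc f = r ^+ 2 - 4 * k ->
  [/\ form (of_form r f) = f, tr (of_form r f) = r & det (of_form r f) = k].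
Proof.
case: f => [[A B] C]; rewrite /disc /qa /qb /qc /= => D.
have [q Bq] : exists q, B = r + 2 * q by apply: (parity_disc r B (A * C - k)); lia.
have e1 : ((r - B) %/ 2)%Z = - q by lia.
have e2 : ((r + B) %/ 2)%Z = r + q by lia.
rewrite /of_form /form /tr /det e1 e2; split; [|lia|].
  by congr (_, _, _); lia.
by rewrite Bq in D; lia.
Qed.

(** A matrix is recovered from its trace and its form; the parity needed to divide by 2 follows from
    the discriminant. *)
Lemma sum_trace p n (r : int) : (`|r| ^ 2 < 4 * p)%N -> (1 < p)%N -> (100 * p <= n)%N ->
  \sum_(M <- box p n | tr M == r) obtuse (form M) =
  \sum_(f <- forms n (4 * p - `|r| ^ 2)) obtuse f.
Proof.
move=> rp p1 pn; set N := (4 * p - `|r| ^ 2)%N.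
have NE : - N%:Z = r ^+ 2 - 4 * p%:Z by rewrite /N; lia.
have r2p : (`|r| <= 2 * p)%N by nia.
rewrite -big_filter; apply: (big_bij_supp _ _ _ _ form (of_form r)).
- by rewrite filter_uniq // box_uniq.
- exact: forms_uniq.
- move=> M; rewrite mem_filter mem_box => /andP[/eqP tM /andP[/eqP dM _]] oM.
  have dF : disc (form M) = - N%:Z by rewrite disc_form tM dM NE.
  split; last exact: of_formK.
  by rewrite mem_forms dF eqxx (fbnd_le _ _ _ _ (obtuse_bnd _ _ dF oM)) //; lia.
- move=> f; rewrite mem_forms => /andP[/eqP dF _] oF.
  have [e1 e2 e3] := form_ofK r f p (etrans dF NE); split=> //.
  rewrite mem_filter mem_box e2 e3 !eqxx /=.
  have := obtuse_bnd _ _ dF oF; case: f {dF oF e1 e2 e3} => [[A B] C].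
  by rewrite /fbnd /qa /qb /qc /bnd /=; lia.
Qed.

Lemma sum_elliptic p n (X : int -> int) : (1 < p)%N -> (100 * p <= n)%N ->
    (forall r, X (- r) = X r) ->
  \sum_(M <- box p n) ellw M * X (tr M) =
  2 * \sum_(r <- rng (2 * p) | (`|r| ^ 2 < 4 * p)%N)
        X r * \sum_(f <- forms n (4 * p - `|r| ^ 2)) obtuse f.
Proof.
move=> p1 pn Xe.
(* [ellw] counts positive definite forms for M and for -M, and X is even; hence the factor 2. *)
have neg : \sum_(M <- box p n) obtuse (form (oppm M)) * X (tr (oppm M)) =
           \sum_(M <- box p n) obtuse (form M) * X (tr M).
  have oppK : involutive oppm by case=> [[[a b] c] d]; rewrite /oppm !opprK.
  apply: (big_bij_supp _ _ _ _ oppm oppm (fun M => obtuse (form M) * X (tr M)));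
      rewrite ?box_uniq //.
    move=> M; rewrite !mem_box => /andP[dM bM] _; split; last exact: oppK.
    by case: M dM bM => [[[a b] c] d]; rewrite /det /bnd /oppm !abszN mulrNN mulrNN => -> ->.
  move=> M; rewrite !mem_box => /andP[dM bM] _; split; last exact: oppK.
  by case: M dM bM => [[[a b] c] d]; rewrite /det /bnd /oppm !abszN mulrNN mulrNN => -> ->.
have -> : \sum_(M <- box p n) ellw M * X (tr M) =
    2 * \sum_(M <- box p n) obtuse (form M) * X (tr M).
  rewrite mulr2n mulrDl mul1r -{2}neg -big_split; apply: eq_bigr => M _.
  rewrite ellwE mulrDl; congr (_ + _ * _); rewrite -Xe; congr X.
  by case: M => [[[a b] c] d]; rewrite /tr /oppm; lia.
congr (_ * _).
under [RHS]eq_bigr => r rp do rewrite -(sum_trace p n r rp p1 pn) mulr_sumr.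
rewrite (exchange_big_dep predT) //=; apply: eq_big_seq => M; rewrite mem_box => /andP[/eqP dM _].
case: (eqVneq (obtuse (form M)) 0) => [->|oM].
  by rewrite mul0r big1 // => r _; rewrite mulr0.
have trp : (`|tr M| ^ 2 < 4 * p)%N.
  by have := obtuse_disc _ oM; rewrite disc_form dM; lia.
have tin : tr M \in rng (2 * p) by rewrite mem_rng; nia.
rewrite big_mkcond (bigD1_seq (tr M)) ?rng_uniq //= trp eqxx big1 ?addr0; last first.
  by move=> r; rewrite eq_sym => /negPf ->; rewrite andbF.
by rewrite mulrC.
Qed.

Lemma intr_F7 (x y : int) : (x%:~R == y%:~R :> 'F_7) = (x == y %[mod 7])%Z.
Proof.
rewrite -subr_eq0 -rmorphB /= -(dvdz_pcharf (pchar_Fp (isT : prime 7))).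
by rewrite eqz_mod_dvd.
Qed.

Lemma square_mod4 (p m : nat) : (m ^ 2 < 4 * p)%N ->
  ~~ (((4 * p - m ^ 2) %% 4 == 1)%N || ((4 * p - m ^ 2) %% 4 == 2)%N).
Proof.
have [k [->|->]] : exists k, m = (2 * k)%N \/ m = (2 * k + 1)%N.
- by exists (m %/ 2)%N; lia.
- by rewrite expnMn => H; lia.
by rewrite sqrnD expnMn => H; lia.
Qed.

Lemma nonsquare (p : nat) : prime p -> forall x : int, p%:Z <> x * x.
Proof.
move=> pp x e; have e' : p = (`|x| ^ 2)%N by rewrite -mulnn -abszM -e.
by move: pp; rewrite e' => /primeP[]; rewrite -mulnn => n1 /(_ `|x|%N);
    rewrite dvdn_mulr // => /(_ isT); nia.
Qed.

Lemma class_number_sum (p : nat) (al : 'F_7) : prime p -> p%:R != 0 :> 'F_7 -> al != 0 ->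
    al ^+ 2 != p%:R ->
  let s : 'F_7 := al + p%:R / al in
  let X (r : int) : int := 6 * (b2i (r%:~R == s) + b2i (r%:~R == - s)) in
  12 * \sum_(r <- rng (2 * p) | (`|r| ^ 2 < 4 * p)%N) (X r)%:~R * H (4 * p - `|r| ^ 2)%N =
  (12 * (p%:Z - 1) * X (p%:Z + 1)
   - (p%:Z * (cuspsum al p%:R 1 - cuspsum' al 1 p%:R) + (cuspsum al 1 p%:R - cuspsum' al p%:R 1))
   + 24 * (p%:Z + 1))%:~R.
Proof.
move=> pp p0 al0 alp s X; have p1 := prime_gt1 pp; set n := (100 * p)%N.
have Xe r : X (- r) = X r.
  by rewrite /X rmorphN /= !eqr_oppLR opprK addrC.
have chiX M : det M = p%:Z -> chi al M = X (tr M).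
  by move=> dM; rewrite chiE // dM.
have := pr_trace p n al al0 p0 (leqnn _) p1 (nonsquare p pp).
rewrite (axial_one p n al) // (grazing_one p n al) //.
rewrite (merel_cusp p n al) // (splitw_sum p n al pp al0 p0 (leqnn _) delta (X (p%:Z + 1)));
    last first.
  (* A triangular matrix of determinant p has trace p + 1 or - (p + 1), and X is even. *)
  move=> M dM c0; have := chiX M dM; rewrite /chi => ->; move: dM c0.
  case: M => [[[a b] c] d] dM /= c0.
  have ad : a * d = p%:Z by move: dM; rewrite c0 /det; lia.
  have /or4P[] := prime_factor p a d pp ad.
  - by case/andP=> /eqP-> /eqP->.
  - by case/andP=> /eqP-> /eqP->; rewrite -Xe; congr X; lia.
  - by case/andP=> /eqP-> /eqP->; rewrite addrC.
  - by case/andP=> /eqP-> /eqP->; rewrite -Xe; congr X; lia.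
have -> : pairing (box p n) al ellw delta = \sum_(M <- box p n) ellw M * X (tr M).
  by apply: eq_big_seq => M; rewrite mem_box => /andP[/eqP dM _]; rewrite -chiX.
rewrite sum_elliptic //.
move: (_ * (_ - _) + _) => phi; move: (X (_ + 1)) => X1.
set Sm := \sum_(r <- _ | _) _ => E.
have {}E : 2 * Sm = 12 * (p%:Z - 1) * X1 - phi + 24 * (p%:Z + 1) by lia.
rewrite -E /Sm !rmorphM /= rmorph_sum /= !mulr_sumr; apply: eq_bigr => r rp.
clearbody X; rewrite rmorphM /= sum_obtuse; first by ring.
- by lia.
- exact: square_mod4.
- by lia.
Qed.

(** Puts the cusp sums into a form that [vm_compute] can evaluate. *)
Lemma big_vec (F : vec -> int) :
  \sum_(x : vec | x != 0) F x = foldr (fun x z => (if x != 0 then F x else 0) + z) 0 vecs.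
Proof.
transitivity (\sum_(x <- vecs) if x != 0 then F x else 0); last by rewrite unlock.
rewrite big_mkcond; apply: perm_big; apply: uniq_perm; rewrite ?index_enum_uniq //.
by move=> x; rewrite mem_index_enum mem_vecs.
Qed.

(** * The sums modulo 7 *)

(** Every r with r^2 < 4 p lies in the range [-2p, 2p] of the list. *)
Definition class_sum (p : nat) (c : int) : rat :=
  \sum_(r <- [seq (i%:Z - (2 * p)%:Z) | i <- iota 0 (4 * p).+1]
        | ((`|r| ^ 2 < 4 * p)%N && (r == c %[mod 7])%Z)) H (4 * p - `|r| ^ 2)%N.

Lemma rngE (p : nat) : [seq (i%:Z - (2 * p)%:Z) | i <- iota 0 (4 * p).+1] = rng (2 * p).
Proof. by rewrite /rng; congr (map _ (iota 0 _)); lia. Qed.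

Lemma class_sumN p c : class_sum p (- c) = class_sum p c.
Proof.
rewrite /class_sum rngE.
have pm : perm_eq (rng (2 * p)) (map -%R (rng (2 * p))).
  apply: uniq_perm; first exact: rng_uniq.
    by rewrite map_inj_uniq ?rng_uniq //; apply: oppr_inj.
  move=> r; rewrite mem_rng; apply/idP/mapP => [h|[t]]; last by rewrite mem_rng => ? ->; lia.
  by exists (- r); rewrite ?opprK // mem_rng; lia.
rewrite [LHS](perm_big _ pm) [LHS]big_map; apply: eq_big => [r|r _]; last by rewrite abszN.
by rewrite abszN -!intr_F7 !rmorphN /= eqr_opp.
Qed.

(** The sums over s and - s agree by symmetry in r, so each [class_sum] is half of the total. Here k
    counts the signs for which the trace p + 1 is s or - s, and l is the common value of the two
    cusp differences. *)
Lemma class_sumE (p : nat) (al : 'F_7) (c : int) (k l : int) : prime p -> p%:R != 0 :> 'F_7 ->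
    al != 0 ->
    al ^+ 2 != p%:R -> let s : 'F_7 := al + p%:R / al in
    (c%:~R == s) || (c%:~R == - s) ->
    b2i (p%:R + 1 == s) + b2i (p%:R + 1 == - s) = k ->
    cuspsum al p%:R 1 - cuspsum' al 1 p%:R = l -> cuspsum al 1 p%:R - cuspsum' al p%:R 1 = l ->
  144 * class_sum p c = (72 * (p%:Z - 1) * k + (24 - l) * (p%:Z + 1))%:~R.
Proof.
move=> pp p0 al0 alp s cs ks l1 l2.
have := class_number_sum p al pp p0 al0 alp; cbv beta zeta; rewrite l1 l2 -/s.
rewrite (_ : (p%:Z + 1)%:~R = p%:R + 1 :> 'F_7) ?ks; last by rewrite rmorphD.
have c_or (d : int) : (d%:~R == s) || (d%:~R == - s) ->
    exists2 e : int, e%:~R = s :> 'F_7 & class_sum p e = class_sum p d.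
  case/orP=> /eqP ds; first by exists d.
  by exists (- d); rewrite ?class_sumN // rmorphN /= ds opprK.
have [e es <-] := c_or c cs.
have sumE (d : int) : \sum_(r <- rng (2 * p) | (`|r| ^ 2 < 4 * p)%N)
    (b2i (r%:~R == d%:~R :> 'F_7))%:~R * H (4 * p - `|r| ^ 2)%N = class_sum p d.
  rewrite /class_sum rngE.
  rewrite [RHS]big_mkcondr /=; apply: eq_bigr => r _.
  by rewrite intr_F7; case: eqP => _; rewrite ?mul1r ?mul0r.
have -> : \sum_(r <- rng (2 * p) | (`|r| ^ 2 < 4 * p)%N)
   (6 * (b2i (r%:~R == s) + b2i (r%:~R == - s)))%:~R * H (4 * p - `|r| ^ 2)%N =
       12 * class_sum p e.
  have eN : (- e)%:~R = - s :> 'F_7 by rewrite rmorphN /= es.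
  transitivity (6 * (class_sum p e + class_sum p (- e))); last by rewrite class_sumN; ring.
  rewrite -!sumE es eN -big_split mulr_sumr /=; apply: eq_bigr => r _.
  by rewrite rmorphM rmorphD /=; ring.
have -> : 144 * class_sum p e = 12 * (12 * class_sum p e) by ring.
by move=> ->; congr (_%:~R); ring.
Qed.

Lemma scale144 (x y : rat) (m : int) : m%:~R = y -> 144 * x = (48 * m)%:~R -> x = y / 3.
Proof. by move=> <-; rewrite rmorphM /= => e; lra. Qed.

Theorem theorem6 (p : nat) (c : int) : prime p ->
  let S := \sum_(r <- [seq (i%:Z - (2 * p)%:Z) | i <- iota 0 (4 * p).+1]
                 | ((`|r| ^ 2 < 4 * p)%N && (r == c %[mod 7])%Z))
             H (4 * p - `|r| ^ 2)%N in
  ((c == 0 %[mod 7])%Z -> ((p %% 7 == 3) || (p %% 7 == 5))%N ->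
      S = (p%:Q + 1) / 3) /\
  ((c == 0 %[mod 7])%Z -> (p %% 7 == 6)%N -> S = (p%:Q - 5) / 3) /\
  (((c == (p + 1)%:Z %[mod 7])%Z || (c == - (p + 1)%:Z %[mod 7])%Z) ->
      (2 <= p %% 7 <= 5)%N -> S = (p%:Q - 2) / 3) /\
  (((c == 2 %[mod 7])%Z || (c == -2 %[mod 7])%Z) -> (p %% 7 == 6)%N ->
      S = (p%:Q + 1) / 3).
Proof.
move=> pp; rewrite -/(class_sum p c); cbv zeta.
have pE k : (p %% 7 = k)%N -> p%:R = k%:R :> 'F_7.
  by move=> <-; rewrite {1}(divn_eq p 7) natrD natrM pchar_Fp_0 // mulr0 add0r.
rewrite -!intr_F7.
(* For c = 0 one needs s = 0, that is al^2 = - p: al is 2, 3, 1 for p = 3, 5, 6 mod 7. *)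
split=> [c0 /orP[]/eqP pk|].
- apply: (scale144 _ _ (p%:Z + 1)); rewrite ?rmorphD // (class_sumE p 2 c 0 (-24)) ?(pE _ pk) //.
  + by congr (_%:~R); ring.
  + by rewrite (eqP c0).
  + by rewrite /cuspsum /cuspsum' !big_vec; vm_compute.
  + by rewrite /cuspsum /cuspsum' !big_vec; vm_compute.
- apply: (scale144 _ _ (p%:Z + 1)); rewrite ?rmorphD // (class_sumE p 3 c 0 (-24)) ?(pE _ pk) //.
  + by congr (_%:~R); ring.
  + by rewrite (eqP c0).
  + by rewrite /cuspsum /cuspsum' !big_vec; vm_compute.
  + by rewrite /cuspsum /cuspsum' !big_vec; vm_compute.
split=> [c0 /eqP pk|].
  (* Here p + 1 = s = - s = 0, so both signs count and k = 2. *)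
  apply: (scale144 _ _ (p%:Z - 5)); rewrite ?rmorphB // (class_sumE p 1 c 2 120) ?(pE _ pk) //.
  + by congr (_%:~R); ring.
  + by rewrite (eqP c0).
  + by rewrite /cuspsum /cuspsum' !big_vec; vm_compute.
  + by rewrite /cuspsum /cuspsum' !big_vec; vm_compute.
split=> [cp pk|cp /eqP pk]; last first.
  (* For p = 6 mod 7, al = 5 gives s = 5 + 6/5 = 2, whereas p + 1 = 0, so k = 0. *)
  apply: (scale144 _ _ (p%:Z + 1)); rewrite ?rmorphD // (class_sumE p 5 c 0 (-24)) ?(pE _ pk) //.
  + by congr (_%:~R); ring.
  + by rewrite /cuspsum /cuspsum' !big_vec; vm_compute.
  + by rewrite /cuspsum /cuspsum' !big_vec; vm_compute.
have e1 : (p + 1)%:Z%:~R = p%:R + 1 :> 'F_7 by rewrite PoszD rmorphD.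
have e2 : (- (p + 1)%:Z)%:~R = - (p%:R + 1) :> 'F_7 by rewrite rmorphN /= e1.
rewrite e1 e2 in cp.
(* The choice al = 1 gives s = p + 1, which differs from - s for these p; hence k = 1, and l =
   48. *)
apply: (scale144 _ _ (p%:Z - 2)); first by rewrite rmorphB.
have -> : 48 * (p%:Z - 2) = 72 * (p%:Z - 1) * 1 + (24 - 48) * (p%:Z + 1) by ring.
have [{}pk|[{}pk|[{}pk|{}pk]]] : (p %% 7 = 2 \/ p %% 7 = 3 \/ p %% 7 = 4 \/ p %% 7 = 5)%N by lia.
all: rewrite (pE _ pk) in cp.
all: apply: (class_sumE p 1) => //; rewrite (pE _ pk).
all: try by [].
all: by rewrite /cuspsum /cuspsum' !big_vec; vm_compute.
Qed.
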